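(* Let $G$ be a graph of order $n$ having no component of order less than $3$. Let $q_0$ be the number of components of $G$ that are stars of even order, let $q_1$ be the number of bipartite components of $G$ with both color classes odd, and let $q_2$ be the number of components of $G$ of odd order. Let $$q_4=\left\lfloor\frac{n-6\left\lceil\frac{q_0}{2}\right\rceil-6q_1-6\left\lfloor\frac{q_2}{2}\right\rfloor-1}{2}\right\rfloor$$ if $q_0$ and $n$ are both odd, and $$q_4=\left\lfloor\frac{n-3q_0-6q_1-6\left\lfloor\frac{q_2}{2}\right\rfloor}{2}\right\rfloor$$ otherwise. Let $\varepsilon(q_0)=3$ if $q_0$ is odd and $n$ is even, and $\varepsilon(q_0)=0$ otherwise. Let $\Gamma$ be an Abelian group of odd order $t\geq n+K(q_0,q_4)$, where $$K(q_0,q_4)=\max\left\{\varepsilon(q_0),\,5q_0-2q_4+\varepsilon(q_0)-1\right\}.$$ Then there exists a $\Gamma$-irregular labeling $f\colon E(G)\to\Gamma$.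
   Context: Graphs are finite, simple and undirected; components are connected components, and the order of a graph is its number of vertices. A color class is odd if it has an odd number of vertices. A star of even order is a graph $K_{1,2u+1}$ with $u\ge 1$ (components here have order at least $3$). For a finite Abelian group $\Gamma$ (written additively) and an edge labeling $f\colon E(G)\to\Gamma$, the weighted degree of a vertex $v$ is $w(v)=\sum_{u\in N(v)}f(uv)$, computed in $\Gamma$, where $N(v)$ is the set of neighbors of $v$. The labeling $f$ is called $\Gamma$-irregular if $w(u)\neq w(v)$ for all distinct $u,v\in V(G)$. *)

(* Defs.v *)
From HB Require Import structures.
From mathcomp Require Import all_boot all_order all_algebra.
Set Implicit Arguments.
Unset Strict Implicit.
Unset Printing Implicit Defensive.
Import Order.TTheory GRing.Theory Num.Theory.

Local Open Scope ring_scope.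

(* A finite simple graph is a finType [T] with a symmetric irreflexive
   adjacency relation [e : rel T]; these two properties are hypotheses of the
   theorem and not of the definitions below. *)
Section Graph.
Variables (T : finType) (e : rel T).

Definition components : {set {set T}} :=
  equivalence_partition (connect e) [set: T].

Definition independent (A : {set T}) : bool :=
  [forall x in A, forall y in A, ~~ e x y].

(* The subgraph induced on C is a K_{1,2u+1} with u >= 1. *)
Definition even_star (C : {set T}) : bool :=
  [&& ~~ odd #|C|, (4 <= #|C|)%N &
   [exists c in C, forall x in C, forall y in C,
      e x y == (x != y) && ((x == c) || (y == c))]].

(* [A] and [B] are the two color classes of [C]; when [C] is a component they
   are unique up to exchange. *)
Definition color_classes (C A B : {set T}) : bool :=
  [&& A :|: B == C, [disjoint A & B], independent A & independent B].

Definition odd_bipartite (C : {set T}) : bool :=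
  [exists A : {set T}, exists B : {set T},
     [&& color_classes C A B, odd #|A| & odd #|B|]].

Definition num_even_stars : nat := #|[set C in components | even_star C]|.

(* Even stars are bipartite with both color classes odd, so they are counted
   here as well. *)
Definition num_odd_bipartite : nat :=
  #|[set C in components | odd_bipartite C]|.

Definition num_odd_order : nat := #|[set C in components | odd #|C|]|.

Section Labeling.
Variables (Gamma : nmodType) (f : {set T} -> Gamma).

(* A labeling is a function on all sets of vertices, of which only the values
   at the edges [set u; v] matter. *)
Definition wdeg (v : T) : Gamma := \sum_(u | e v u) f [set u; v].

Definition irregular_labeling : Prop :=
  forall u v : T, u <> v -> wdeg u <> wdeg v.

End Labeling.
End Graph.

(* [q4] may be negative, so it is an integer; [intdiv] by 2 is the floor. *)
Definition q4 (n q0 q1 q2 : nat) : int :=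
  if odd q0 && odd n then
    ((n%:Z - 6 * (uphalf q0)%:Z - 6 * q1%:Z - 6 * (q2./2)%:Z - 1) %/ 2)%Z
  else
    ((n%:Z - 3 * q0%:Z - 6 * q1%:Z - 6 * (q2./2)%:Z) %/ 2)%Z.

Definition epsilon (n q0 : nat) : int := if odd q0 && ~~ odd n then 3 else 0.

Definition K (n q0 : nat) (q : int) : int :=
  Num.max (epsilon n q0) (5 * q0%:Z - 2 * q + epsilon n q0 - 1).

(* Main.v *)
(* A function w : V(G) -> Gamma is the weighted degree function of an edge
   labeling iff every bipartite component gets the same total weight on its two
   color classes: labels alternating x, -x along a walk change only the degrees
   of its ends, and in a non-bipartite component a closed odd walk changes one
   vertex by 2x, that is, since |Gamma| is odd, by an arbitrary amount.  So one
   has to place distinct group elements on the vertices with balanced classes.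

   Classes are filled with pairs {x, -x} except for a small core.  A hexad
   {a, b, c, -a, -b, -c} with a + b + c = 0 balances a component with both
   classes odd (three against three) or two components of odd order
   (a + b against a, b, and its negative).  An octad, made of x + y + z, x, y, z
   and their negatives, balances two even stars.  An unpaired star uses 0 and
   half a hexad, whose other half serves an unpaired component of odd order if
   there is one.

   Every abelian group of odd order t contains (t-1)/6, rounded down, disjoint
   hexads.  If 3 divides t, the hexads generated by 2x and g - x do, with g
   outside a subgroup H of index 3 and x in half of H.  Cyclic groups follow from
   Skolem and hooked Skolem sequences.  A non-cyclic group with t prime to 3 has
   a quotient (Z/p)^2, partitioned by the orbits of -w, where
   w(a, b) = (-b, a - b) satisfies 1 + w + w^2 = 0; hexads lift from the quotient
   as (a + h, b + h, c - 2h), and the kernel is handled by induction.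

   Finally k octads chosen greedily meet at most 4k hexads of a maximal family,
   and the bound on t leaves enough of the others. *)
Require Import Defs.
From HB Require Import structures.
From mathcomp Require Import all_boot all_order all_algebra.
From mathcomp Require Import all_fingroup all_solvable zify ring.
Set Implicit Arguments.
Unset Strict Implicit.
Unset Printing Implicit Defensive.
Import Order.TTheory GRing.Theory Num.Theory.

(** * Skolem sequences *)

(* The pairs [(a d, a d + d)] partition [1 .. 2m], or, for [m] congruent to 2 or
   3 modulo 4, the same interval with [2m] replaced by [2m + 1] (a hooked Skolem
   sequence).  The formulas below are the classical explicit sequences, read as
   functions of the difference [d]. *)
Definition skolem_starts (m : nat) (a : nat -> nat) : Prop :=
  forall d d', 0 < d <= m -> 0 < d' <= m ->
  [/\ 0 < a d, a d + d <= (2 * m).+1,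
      a d = a d' \/ a d + d = a d' + d' -> d = d', a d <> a d' + d' &
      if m %% 4 < 2 then a d + d <= 2 * m
      else (a d != 2 * m) && (a d + d != 2 * m)].

(** The explicit families below cover the orders from 6 on, so the smaller ones are tabulated: row
    [m] lists the starts of the differences 1 .. m. *)
Lemma skolem_starts_small m : m < 6 -> exists a, skolem_starts m a.
Proof.
move=> m6; pose tab := [:: [::]; [:: 1]; [:: 1; 3]; [:: 2; 5; 1];
  [:: 1; 5; 3; 4]; [:: 8; 1; 4; 2; 5]].
exists (fun d => nth 0 (nth [::] tab m) d.-1) => -[|d] [|d'] // dm dm'.
case: m m6 dm dm' => [|[|[|[|[|[|m]]]]]] // _;
  case: d => [|[|[|[|[|d]]]]] // _; case: d' => [|[|[|[|[|d']]]]] // _;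
  by split=> // -[].
Qed.

(** Even differences give nested pairs with midpoint 6s. Odd ones give nested pairs whose entries
    add up to 4s - 1 (large differences) or 4s + 1 (small ones); the exceptional differences 1, 2s -
    1, 2s + 1 and 4s - 1 fill the gaps. The other three families are built alike. *)
Lemma skolem_starts0 s : 1 < s -> exists a, skolem_starts (4 * s) a.
Proof.
move=> s1; exists (fun d => if ~~ odd d then 6 * s - d./2
  else if d == 1 then s else if d == 4 * s - 1 then (2 * s).+1
  else if d == (2 * s).+1 then s - 1 else if d == 2 * s - 1 then 2 * s
  else if (2 * s).+1 < d then 2 * s - d./2.+1 else (2 * s).+1 - d./2.+1).
move=> d d' dm dm' /=.
have -> : (4 * s) %% 4 < 2 by lia.
have := odd_double_half d; have := odd_double_half d'.
move: (odd d) (d./2) (odd d') (d'./2) => b h b' h'.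
by case: b; case: b' => /= e' e; split; do ? [case: ifP => ?]; lia.
Qed.

Lemma skolem_starts1 s : 1 < s -> exists a, skolem_starts (4 * s).+1 a.
Proof.
move=> s1; exists (fun d => if ~~ odd d then 6 * s + 2 - d./2
  else if d == 1 then s.+1 else if d == (4 * s).+1 then (2 * s).+1
  else if d == 2 * s - 1 then 2 * s + 2
  else if 2 * s < d then (2 * s).+1 - d./2.+1 else 2 * s + 2 - d./2.+1).
move=> d d' dm dm' /=.
have -> : (4 * s).+1 %% 4 < 2 by lia.
have := odd_double_half d; have := odd_double_half d'.
move: (odd d) (d./2) (odd d') (d'./2) => b h b' h'.
by case: b; case: b' => /= e' e; split; do ? [case: ifP => ?]; lia.
Qed.

Lemma skolem_starts2 s : 0 < s -> exists a, skolem_starts (4 * s + 2) a.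
Proof.
move=> s1; exists (fun d =>
  if d == 4 * s + 2 then 4 * s + 3 else if ~~ odd d then (2 * s).+1 - d./2
  else if d == 1 then 7 * s + 3 else if d == (4 * s).+1 then (2 * s).+1
  else if d == (2 * s).+1 then 4 * s + 2
  else if (2 * s).+1 < d then 6 * s + 4 - d./2.+1 else 6 * s + 3 - d./2.+1).
move=> d d' dm dm' /=.
have -> : ((4 * s + 2) %% 4 < 2) = false by lia.
have := odd_double_half d; have := odd_double_half d'.
move: (odd d) (d./2) (odd d') (d'./2) => b h b' h'.
by case: b; case: b' => /= e' e; split; do ? [case: ifP => ?]; lia.
Qed.

Lemma skolem_starts3 s : 1 < s -> exists a, skolem_starts (4 * s - 1) a.
Proof.
move=> s1; exists (fun d =>
  if d == 4 * s - 2 then (2 * s).+1 else if ~~ odd d then 6 * s - 1 - d./2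
  else if d == 1 then s else if d == 4 * s - 1 then 4 * s
  else if d == (2 * s).+1 then s - 1 else if d == 2 * s - 1 then 2 * s
  else if (2 * s).+1 < d then 2 * s - d./2.+1 else (2 * s).+1 - d./2.+1).
move=> d d' dm dm' /=.
have -> : ((4 * s - 1) %% 4 < 2) = false by lia.
have := odd_double_half d; have := odd_double_half d'.
move: (odd d) (d./2) (odd d') (d'./2) => b h b' h'.
by case: b; case: b' => /= e' e; split; do ? [case: ifP => ?]; lia.
Qed.

Lemma skolem_starts_exist m : exists a, skolem_starts m a.
Proof.
have [/skolem_starts_small //|m6] := ltnP m 6.
have := divn_eq m 4; move: (m %/ 4) (ltn_pmod m (isT : 0 < 4)) => s.
case: (m %% 4) => [|[|[|[|r]]]] // _ em.
- have -> : m = 4 * s by lia. by apply: skolem_starts0; lia.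
- have -> : m = (4 * s).+1 by lia. by apply: skolem_starts1; lia.
- have -> : m = 4 * s + 2 by lia. by apply: skolem_starts2; lia.
have -> : m = 4 * s.+1 - 1 by lia. by apply: skolem_starts3; lia.
Qed.

(* The last clause excludes that both [3 m] and [3 m + 1] occur; hence no two
   entries are opposite modulo an odd number greater than [6 m]. *)
Lemma skolem_triads m : exists L : seq (nat * nat),
  let T := flatten [seq [:: p.1; p.2; p.1 + p.2] | p <- L] in
  [/\ size L = m, uniq T, {in T, forall u, 0 < u <= (3 * m).+1} &
      {in T &, forall u v, u + v <> (6 * m).+1}].
Proof.
have [a aP] := skolem_starts_exist m.
(* Shifting the Skolem pairs by [m] makes room for the differences 1 .. m themselves. *)
exists [seq (d, m + a d) | d <- iota 1 m] => T.
pose f1 d := m + a d; pose f2 d := d + (m + a d).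
have mem_f d : (d \in iota 1 m) = (0 < d <= m) by rewrite mem_iota; lia.
have permT : perm_eq T (iota 1 m ++ map f1 (iota 1 m) ++ map f2 (iota 1 m)).
  rewrite /T; elim: (iota 1 m) => //= d l IH.
  rewrite perm_cons; apply/seq.permP => P; move/seq.permP/(_ P): IH.
  by rewrite /= !count_cat /= !count_cat /= /f1 /f2 => ->; lia.
have memT u : u \in T ->
    exists2 d, 0 < d <= m & [\/ u = d, u = f1 d | u = f2 d].
  rewrite (perm_mem permT) !mem_cat => /or3P[|/mapP[d]|/mapP[d]].
  - by rewrite mem_f => um; exists u => //; constructor 1.
  - by rewrite mem_f => dm ->; exists d => //; constructor 2.
  by rewrite mem_f => dm ->; exists d => //; constructor 3.
split; first by rewrite size_map size_iota.
- rewrite (perm_uniq permT) !cat_uniq iota_uniq /=.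
  rewrite !map_inj_in_uniq ?iota_uniq ?has_cat ?negb_or /=.
  + rewrite ?andbT -?andbA; apply/and3P; split.
    * apply/hasPn=> _ /mapP[d + ->]; rewrite !mem_f /f1 => dm.
      by case: (aP d d dm dm); lia.
    * apply/hasPn=> _ /mapP[d + ->]; rewrite !mem_f /f2 => dm.
      by case: (aP d d dm dm); lia.
    apply/hasPn=> _ /mapP[d + ->]; rewrite mem_f => dm.
    apply/mapP=> -[d' + ]; rewrite mem_f /f1 /f2 => dm' e.
    by case: (aP d' d dm' dm); lia.
  + by move=> d d'; rewrite !mem_f /f2 => dm dm'; case: (aP d d' dm dm'); lia.
  + by move=> d d'; rewrite !mem_f /f1 => dm dm'; case: (aP d d' dm dm'); lia.
- move=> u /memT[d dm]; case: (aP d d dm dm) => ? ? _ _ _.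
  by rewrite /f1 /f2 => -[] ->; lia.
move=> u v /memT[d dm ud] /memT[d' dm' vd].
case: (aP d d dm dm) => ? ? _ _; case: (aP d' d' dm' dm') => ? ? _ _.
by rewrite /f1 /f2 in ud vd; case: ud; case: vd; case: ifP; lia.
Qed.

(** Thus the nonzero elements of (Z/p)^2 split into hexads without remainder, and no hexad is lost
    to rounding when passing to this quotient. *)
Lemma sqr_mod6 p : odd p -> ~~ (3 %| p) -> exists k, p ^ 2 = (6 * k).+1.
Proof.
move=> p_odd p3; have := divn_eq p 6; move: (p %/ 6) (ltn_pmod p (isT : 0 < 6)) => a.
case: (p %% 6) => [|[|[|[|[|[|r]]]]]] // _ pE; rewrite {p}pE in p_odd p3 *; try by lia.
  by exists (6 * a * a + 2 * a); rewrite -mulnn; lia.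
by exists (6 * a * a + 10 * a + 4); rewrite -mulnn; lia.
Qed.

(** For a subgroup of order 2k + 1 and index 3, the k hexads indexed by half of its nonzero elements
    reach the required number. *)
Lemma third_half k : ((2 * k).+1 * 3).-1 %/ 6 = k.
Proof. lia. Qed.

(** * Subgroups of prime index in abelian groups *)

Section AbelianSubgroups.
Import GroupScope.

(** G is the direct product of its p-part and its p'-part, so adjoining the p'-part to M keeps the
    index p. The last identity recovers M, hence different M give different subgroups of G. *)
Lemma Sylow_maximal_index (gT : finGroupType) (p : nat) (G M : {group gT}) :
  prime p -> abelian G -> maximal M 'O_p(G) ->
  [/\ M <*> 'O_p^'(G) \subset G, #|G : M <*> 'O_p^'(G)| = p
    & M <*> 'O_p^'(G) :&: 'O_p(G) = M].
Proof.
move=> p_pr abG maxM; have nilG := abelian_nil abG.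
have [_ defG cPL tiPL] := dprodP (nilpotent_pcoreC p nilG).
have sMP : M \subset 'O_p(G) by have/maxgroupp := maxM; case/andP.
have sLG : 'O_p^'(G) \subset G := pcore_sub _ _.
have sMG : M \subset G := subset_trans sMP (pcore_sub _ _).
have cML : 'O_p^'(G) \subset 'C(M) by apply: sub_abelian_cent2 abG _ _.
have defML : M <*> 'O_p^'(G) = M * 'O_p^'(G) by rewrite (cent_joinEr cML).
split; first by rewrite join_subG sMG sLG.
  have tiML : M :&: 'O_p^'(G) = 1.
    by apply/trivgP; rewrite -tiPL setSI.
  have iM : #|'O_p(G) : M| = p by apply: p_maximal_index maxM; apply: pcore_pgroup.
  have cG : #|G| = (#|'O_p(G)| * #|'O_p^'(G)|)%N by rewrite -TI_cardMg // defG.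
  have cML' : #|M <*> 'O_p^'(G)| = (#|M| * #|'O_p^'(G)|)%N.
    by rewrite defML TI_cardMg.
  rewrite -divgS ?join_subG ?sMG //= cML' cG -(Lagrange sMP) iM mulnAC mulKn //.
  by rewrite muln_gt0 !cardG_gt0.
by rewrite defML -group_modl // setIC tiPL mulg1.
Qed.

Lemma exists_index_prime (gT : finGroupType) (p : nat) (G : {group gT}) :
  abelian G -> prime p -> (p %| #|G|)%N ->
  exists2 H : {group gT}, H \subset G & #|G : H| = p.
Proof.
move=> abG p_pr pG.
have sylP := nilpotent_pcore_Hall p (abelian_nil abG).
have ntP : 'O_p(G) != 1.
  by rewrite -cardG_gt1 (card_Hall sylP) p_part_gt1 mem_primes p_pr cardG_gt0.
have [P1|[M maxM _]] := maximal_exists (sub1G 'O_p(G)).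
  by rewrite -P1 eqxx in ntP.
by have [sMG iM _] := Sylow_maximal_index p_pr abG maxM; exists (M <*> 'O_p^'(G))%G.
Qed.

(** A nilpotent group with cyclic Sylow subgroups is cyclic, so some Sylow subgroup P is not. For x
    in P outside a maximal M1, the cyclic group of x is proper in P and lies in a second maximal
    M2. *)
Lemma noncyclic_index_prime (gT : finGroupType) (G : {group gT}) :
  abelian G -> ~~ cyclic G ->
  exists p (M1 M2 : {group gT}), [/\ prime p, M1 != M2 :> {set gT},
    M1 \subset G, M2 \subset G & #|G : M1| = p /\ #|G : M2| = p].
Proof.
move=> abG ncG; have nilG := abelian_nil abG.
have : ~~ Zgroup G by apply: contra ncG => /nil_Zgroup_cyclic ->.
case/forall_inPn=> P /SylowP[p p_pr sylP] ncP.
have defP : P :=: 'O_p(G) by apply: (nilpotent_Hall_pcore nilG sylP).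
have [P1|[M1 maxM1 _]] := maximal_exists (sub1G 'O_p(G)).
  by rewrite defP -P1 cyclic1 in ncP.
have [sM1P [x xP xM1]] := properP (maxgroupp maxM1).
have [cxP|[M2 maxM2 sxM2]] := maximal_exists (etrans (cycle_subG x 'O_p(G)) xP).
  by rewrite defP -cxP cycle_cyclic in ncP.
have [sM1G iM1 M1P] := Sylow_maximal_index p_pr abG maxM1.
have [sM2G iM2 M2P] := Sylow_maximal_index p_pr abG maxM2.
exists p, (M1 <*> 'O_p^'(G))%G, (M2 <*> 'O_p^'(G))%G; split=> //.
apply: contraNneq xM1 => /= eM.
by rewrite -M1P eM M2P -cycle_subG.
Qed.

Lemma expg_index_mem (gT : finGroupType) (G H : {group gT}) x :
  H <| G -> x \in G -> x ^+ #|G : H| \in H.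
Proof.
move=> nHG xG; have [_ nH] := andP nHG; have xN := subsetP nH _ xG.
apply: coset_idr; first exact: groupX.
by rewrite morphX // -card_quotient // expg_cardG // mem_quotient.
Qed.

Lemma expg_mem_index_prime (gT : finGroupType) (G H : {group gT}) x n :
  H <| G -> prime #|G : H| -> x \in G -> x \notin H -> x ^+ n \in H ->
  #|G : H| %| n.
Proof.
move=> nHG p_pr xG xH xn; have [_ nH] := andP nHG; have xN := subsetP nH _ xG.
have : #[coset H x] %| #|G : H|.
  by rewrite order_dvdn -morphX //= coset_id ?eqxx // expg_index_mem.
case/primeP: p_pr => _ /[apply] /orP[|/eqP <-]; last first.
  by rewrite order_dvdn -morphX //= coset_id.
by rewrite order_eq1 => /eqP/(coset_idr xN) xH'; rewrite xH' in xH.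
Qed.

(** H is the intersection of two subgroups of index p, with u and v taken in one but not in the
    other. The clauses on u and v say, without quotient types, that they form a basis of K/H, a copy
    of (Z/p)^2. *)
Lemma noncyclic_prime_square_index (gT : finGroupType) (K : {group gT}) :
  abelian K -> ~~ cyclic K -> exists (p : nat) (H : {group gT}) u v,
    [/\ prime p, H \subset K /\ #|K| = (p ^ 2 * #|H|)%N, u \in K /\ v \in K,
      u ^+ p \in H /\ v ^+ p \in H &
      forall i j, u ^+ i * v ^+ j \in H -> (p %| i) && (p %| j)].
Proof.
move=> abK ncK.
have [p [M1 [M2 [p_pr neM sM1 sM2 [i1 i2]]]]] := noncyclic_index_prime abK ncK.
have nM1 : M1 <| K by rewrite /normal sM1 (sub_abelian_norm abK).
have nM2 : M2 <| K by rewrite /normal sM2 (sub_abelian_norm abK).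
have c12 : #|M1| = #|M2|.
  apply/eqP; rewrite -(eqn_pmul2r (indexg_gt0 K M1)) (Lagrange sM1) i1 -i2.
  by rewrite (Lagrange sM2).
have n21 : ~~ (M2 \subset M1).
  by apply: contra neM => s21; rewrite eq_sym eqEcard s21 c12 leqnn.
have n12 : ~~ (M1 \subset M2).
  by apply: contra neM => s12; rewrite eqEcard s12 c12 leqnn.
have [u uM2 uM1] := subsetPn n21; have [v vM1 vM2] := subsetPn n12.
have uK := subsetP sM2 _ uM2; have vK := subsetP sM1 _ vM1.
have defK : M1 * M2 = K.
  have sJ : M1 <*> M2 \subset K by rewrite join_subG sM1.
  have := Lagrange_index sJ (joing_subl M1 M2); rewrite i1 => e.
  have c : #|K : M1 <*> M2| == 1%N.
    have d1 : #|M1 <*> M2 : M1| %| p by rewrite -e dvdn_mull.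
    have /primeP[_ /(_ _ d1) /orP[|/eqP ep]] := p_pr.
      rewrite indexg_eq1 => sJM; case/negP: n21.
      exact: subset_trans (joing_subr M1 M2) sJM.
    move/eqP: e; rewrite ep -[X in _ == X]mul1n eqn_pmul2r ?prime_gt0 //.
  rewrite -norm_joinEl ?(subset_trans sM1) ?(normal_norm nM2) //.
  by apply/eqP; rewrite eqEsubset sJ -indexg_eq1.
exists p, (M1 :&: M2)%G, u, v; split=> //.
- split; first by rewrite subIset ?sM1.
  have eK : #|K| = (#|M1| * p)%N by rewrite -(Lagrange sM1) i1.
  have := mul_cardG M1 M2; rewrite defK eK -c12 -mulnA => /eqP.
  by rewrite eqn_pmul2l ?cardG_gt0 //= => /eqP ->; rewrite mulnAC mulnn.
- have uM1' : u ^+ p \in M1 by rewrite -i1 expg_index_mem.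
  have vM2' : v ^+ p \in M2 by rewrite -i2 expg_index_mem.
  by rewrite !inE uM1' vM2' !groupX.
move=> i j /setIP[m1 m2]; apply/andP; split.
  rewrite -i1; apply: expg_mem_index_prime uK uM1 _; rewrite ?i1 //.
  by move: m1; rewrite groupMr // groupX.
rewrite -i2; apply: expg_mem_index_prime vK vM2 _; rewrite ?i2 //.
by move: m2; rewrite groupMl // groupX.
Qed.
End AbelianSubgroups.

Local Open Scope ring_scope.

(** * Disjoint zero-sum triples together with their opposites *)

Section Hexads.
Variable V : finZmodType.
Implicit Types (p : V * V) (s : seq (V * V)).

(** The pair stands for (a, b); the third element is c = -(a + b). Opposite elements are three
    positions apart. *)
Definition hexad p := [:: p.1; p.2; - (p.1 + p.2); - p.1; - p.2; p.1 + p.2].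
Definition hexads s := flatten (map hexad s).
(** One element of each opposite pair of the hexad; -c is taken instead of c, which matches the
    positive integers of a Skolem triple. *)
Definition triad p := [:: p.1; p.2; p.1 + p.2].
Definition triads s := flatten (map triad s).

Lemma size_hexads s : size (hexads s) = (6 * size s)%N.
Proof. by elim: s => //= p s; rewrite /hexads /= => ->; lia. Qed.

Lemma hexads_cat s1 s2 : hexads (s1 ++ s2) = hexads s1 ++ hexads s2.
Proof. by rewrite /hexads map_cat flatten_cat. Qed.

Lemma perm_hexads_triads s :
  perm_eq (hexads s) (triads s ++ map -%R (triads s)).
Proof.
apply/seq.permP=> P; elim: s => //= p s IH.
rewrite -/(hexads s) -/(triads s) IH !count_cat /=; lia.
Qed.

Lemma mem_hexadN p x : (- x \in hexad p) = (x \in hexad p).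
Proof. by rewrite !inE !eqr_oppLR !opprK; do 6 case: (x == _) => /=. Qed.

Lemma mem_hexadsN s x : (- x \in hexads s) = (x \in hexads s).
Proof.
by apply/flatten_mapP/flatten_mapP => -[p ps xp]; exists p => //;
  rewrite mem_hexadN in xp *.
Qed.

Lemma uniq_catN (s : seq V) :
  uniq s -> {in s &, forall x y, x + y != 0} -> uniq (s ++ map -%R s).
Proof.
move=> us sN; rewrite cat_uniq us (map_inj_uniq oppr_inj) us andbT /=.
apply/hasPn=> _ /mapP[x xs ->]; apply/negP => ys.
by have := sN _ _ ys xs; rewrite addNr eqxx.
Qed.

Lemma uniq_hexads s : uniq (triads s) ->
  {in triads s &, forall x y, x + y != 0} -> uniq (hexads s).
Proof. by rewrite (perm_uniq (perm_hexads_triads s)); apply: uniq_catN. Qed.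

Hypothesis V_odd : odd #|V|.

Lemma double_inj : injective (fun x : V => x *+ 2).
Proof.
have [k Vk] : exists k, #|V| = (2 * k).+1 by exists #|V|./2; lia.
(* With |V| = 2k + 1, multiplication by k + 1 is halving. *)
apply: (can_inj (g := fun x => x *+ k.+1)) => x.
rewrite -mulrnA (_ : 2 * k.+1 = #|V| + 1)%N; last lia.
rewrite mulrnDr (_ : x *+ #|V| = 0) ?add0r //.
by apply/eqP; rewrite -(FinRing.zmodXgE #|V| x) -cardsT -order_dvdn order_dvdG ?inE.
Qed.

Lemma addrr_eq0 (x : V) : (x + x == 0) = (x == 0).
Proof. by rewrite -mulr2n -(inj_eq double_inj x 0) mul0rn. Qed.

Lemma neg_eq (x : V) : (- x == x) = (x == 0).
Proof. by rewrite eq_sym -addr_eq0 addrr_eq0. Qed.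

(** Induction removes {x, -x}, which has two elements because a nonzero element of a group of odd
    order differs from its opposite. *)
Lemma half_system (U : {set V}) : 0 \notin U -> {in U, forall x, - x \in U} ->
  exists X : seq V, uniq (X ++ map -%R X) /\ X ++ map -%R X =i U.
Proof.
have [n] := ubnP #|U|; elim: n U => // n IH U Un U0 UN.
have [->|[x xU]] := set_0Vmem U; first by exists [::]; split=> // x; rewrite inE.
have x0 : x != 0 by apply: contraNneq U0 => <-.
have [|||X [uX memX]] := IH (U :\: [set x; - x]).
- have : (#|U :\ x| < n)%N by move: Un; rewrite (cardsD1 x) xU.
  by apply: leq_ltn_trans; rewrite subset_leq_card // setDS // sub1set !inE eqxx.
- by rewrite !inE negb_and U0 orbT.
- move=> y; rewrite !inE (eqr_oppLR y) eqr_opp => /andP[yx /UN ->].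
  by rewrite orbC yx.
exists (x :: X); split; last first.
  move=> y; rewrite mem_cat /= !inE.
  have := memX y; rewrite mem_cat !inE.
  have [->|_] := eqVneq y x; first by rewrite xU.
  by have [->|_] := eqVneq y (- x); rewrite /= ?(UN _ xU) ?orbT.
have xX : x \notin X ++ map -%R X by rewrite memX !inE eqxx.
have NxX : - x \notin X ++ map -%R X by rewrite memX !inE eqxx orbT.
rewrite (perm_uniq (_ : perm_eq _ [:: x, - x & X ++ map -%R X])).
  by rewrite /= uX inE negb_or xX NxX eq_sym neg_eq x0.
by rewrite /= perm_cons -(cat1s (- x)) perm_catCA.
Qed.

End Hexads.

Lemma uniq_flatten_map_inj (S U : eqType) (f : S -> seq U) (s : seq S) p q x :
  uniq (flatten (map f s)) -> p \in s -> q \in s -> x \in f p -> x \in f q ->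
  p = q.
Proof.
elim: s => //= r s IH; rewrite cat_uniq => /and3P[_ /hasPn dis us].
have disj y z : y \in s -> z \in f y -> z \in f r -> False.
  by move=> ys zy; apply/negP/dis; apply/flatten_mapP; exists y.
rewrite !inE => /predU1P[->|ps] /predU1P[->|qs] // xp xq; last exact: IH.
- by case: (disj _ _ qs xq).
- by case: (disj _ _ ps xp).
Qed.

Section HexadsInj.
Variable V : finZmodType.
Implicit Types (p q : V * V) (s : seq (V * V)).

(** Indexing by position turns the absence of repetitions into injectivity in the pair of a hexad
    and a position, the form suited to lifting from a quotient. *)
Lemma hexads_allpairs s :
  hexads s = [seq nth 0 (hexad p) k | p <- s, k <- iota 0 6].
Proof. by []. Qed.

Lemma hexads_cons p s : hexads (p :: s) = hexad p ++ hexads s.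
Proof. by []. Qed.

Lemma uniq_hexad s p : uniq (hexads s) -> p \in s -> uniq (hexad p).
Proof.
elim: s => // q s IH; rewrite hexads_cons cat_uniq => /and3P[uq _ us].
by rewrite inE => /predU1P[->|/IH]; last apply.
Qed.

Lemma uniq_of_hexads s : uniq (hexads s) -> uniq s.
Proof.
elim: s => // p s IH; rewrite hexads_cons cat_uniq => /and3P[_ /hasPn dis /IH us] /=.
rewrite us andbT; apply/negP => ps.
have /dis : p.1 \in hexads s by apply/flatten_mapP; exists p; rewrite ?inE ?eqxx.
by rewrite /= inE eqxx.
Qed.

Lemma hexads_inj s p q (k l : nat) :
  uniq (hexads s) -> p \in s -> q \in s -> (k < 6)%N -> (l < 6)%N ->
  nth 0 (hexad p) k = nth 0 (hexad q) l -> p = q /\ k = l.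
Proof.
move=> us ps qs k6 l6 e.
have epq : p = q.
  apply: (@uniq_flatten_map_inj (V * V)%type V (@hexad V) s p q (nth 0 (hexad p) k)) => //.
    exact: mem_nth.
  by rewrite e; apply: mem_nth.
split=> //; subst q; apply/eqP; rewrite -(nth_uniq 0 _ _ (uniq_hexad us ps)) //.
exact/eqP.
Qed.

Lemma inj_hexads s : uniq s ->
  (forall p q (k l : nat), p \in s -> q \in s -> (k < 6)%N -> (l < 6)%N ->
   nth 0 (hexad p) k = nth 0 (hexad q) l -> p = q /\ k = l) -> uniq (hexads s).
Proof.
move=> us inj; rewrite hexads_allpairs; apply: allpairs_uniq => //.
move=> [p k] [q l] /allpairsP[[p' k'] [ps k6 [-> ->]]].
case/allpairsP=> [[q' l'] [qs l6 [-> ->]]] /= e.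
rewrite !mem_iota /= in k6 l6.
by have [/= -> ->] := inj _ _ _ _ ps qs k6 l6 e.
Qed.

(** The opposite of an entry sits at another position of its hexad, so 0 would occur twice. *)
Lemma uniq_hexads0 s x : uniq (hexads s) -> x \in hexads s -> x != 0.
Proof.
move=> us /flatten_mapP[p ps xp]; have := uniq_hexad us ps.
apply: contraTneq => x0; rewrite {}x0 !inE !(eq_sym 0) !oppr_eq0 in xp.
rewrite /= !inE.
by case/or4P: xp => [/eqP->|/eqP->|/eqP->|/or3P[/eqP->|/eqP->|/eqP->]];
  rewrite ?oppr0 ?eqxx ?orbT /= ?andbF.
Qed.

Lemma hexads_cycle (x : V) : odd #|V| -> exists s,
  [/\ uniq (hexads s), {subset hexads s <= <[x]>%g} & size s = (#[x]%g.-1 %/ 6)%N].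
Proof.
move=> oV; pose m := (#[x]%g.-1 %/ 6)%N.
have ox : odd #[x]%g by apply: dvdn_odd oV; rewrite -cardsT order_dvdG ?inE.
have [L [sL uL rL L6]] := skolem_triads m.
pose f v := x *+ v; pose fL := [seq (f r.1, f r.2) | r : nat * nat <- L].
have f_eq u v : (f u == f v) = (u == v %[mod #[x]%g]).
  by rewrite /f -!(FinRing.zmodXgE _ x) eq_expg_mod_order.
(* An entry exists only if [m] is positive; then 3m + 1 is below the order of [x], and entries are
   reduced residues. *)
have {}rL u : u \in flatten [seq [:: r.1; r.2; (r.1 + r.2)%N] | r <- L] ->
    (0 < m)%N && (0 < u <= (3 * m).+1)%N.
  by move=> uT; rewrite rL // andbT -sL; case: (L) uT.
have mx : (6 * m < #[x]%g)%N.
  by rewrite -[X in (_ < X)%N]prednK ?order_gt0 // ltnS mulnC leq_trunc_div.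
exists fL.
have tri : triads fL =
    map f (flatten [seq [:: r.1; r.2; (r.1 + r.2)%N] | r : nat * nat <- L]).
  rewrite map_flatten /triads -!map_comp; congr flatten; apply: eq_map => r /=.
  by rewrite /triad /= /f mulrnDr.
split; last by rewrite size_map sL.
  apply: uniq_hexads; rewrite tri.
    rewrite map_inj_in_uniq // => u v /rL ur /rL vr /eqP.
    by rewrite f_eq => /eqP; rewrite !modn_small //; lia.
  move=> _ _ /mapP[u uT ->] /mapP[v vT ->].
  have -> : f u + f v = f (u + v)%N by rewrite /f mulrnDr.
  have <- : f 0%N = 0 by rewrite /f mulr0n.
  rewrite f_eq mod0n.
  (* The sum is positive and at most 6m + 2, hence it can only equal the order of [x] itself. That
     order is odd and exceeds 6m, so it would be 6m + 1, the value excluded for Skolem triples. *)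
  apply/negP => /dvdnP[k e]; have := rL _ uT; have := rL _ vT; have := L6 _ _ uT vT.
  rewrite e; case: k e => [|[|k]]; lia.
move=> y; rewrite (perm_mem (perm_hexads_triads _)) tri mem_cat.
have fx u : f u \in <[x]>%g by rewrite /f -(FinRing.zmodXgE _ x) mem_cycle.
case/orP=> [/mapP[u _ ->] //|/mapP[_ /mapP[u _ ->] ->]].
exact: (groupVr (fx u)).
Qed.

(** The relation forces w^3 = 1, so a nonzero x gives the hexad of x, w x, w^2 x and their
    opposites; these six differ since neither 2 nor 3 annihilates a nonzero element. Induction runs
    over sets closed under w and negation. *)
Lemma hexads_orbit (w : V -> V) : {morph w : x / - x} ->
  (forall x, x + w x + w (w x) = 0) -> (forall x : V, x *+ 2 = 0 -> x = 0) ->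
  (forall x : V, x *+ 3 = 0 -> x = 0) ->
  exists s, uniq (hexads s) /\ size s = (#|V|.-1 %/ 6)%N.
Proof.
move=> wN wS V2 V3.
have ww x : w (w x) = - (x + w x) by apply/eqP; rewrite -addr_eq0 addrC wS.
have www x : w (w (w x)) = x.
  by rewrite (ww (w x)) (ww x) opprD opprK addrC addrK.
have w_inj : injective w by apply: (can_inj (g := w \o w)) => y /=.
have w0 : w 0 = 0 by apply: V2; rewrite mulr2n -{1}oppr0 wN addNr.
have w_eq0 x : (w x == 0) = (x == 0) by rewrite -{1}w0 (inj_eq w_inj).
suff gen (U : {set V}) : 0 \notin U -> {in U, forall x, - x \in U} ->
    {in U, forall x, w x \in U} -> exists s, uniq (hexads s) /\ hexads s =i U.
  have [|||s [us ms]] := gen [set~ 0]; first by rewrite !inE eqxx.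
  - by move=> x; rewrite !inE oppr_eq0.
  - by move=> x; rewrite !inE w_eq0.
  exists s; split=> //.
  by rewrite -(cardsC1 (0 : V)) -(eq_card ms) (card_uniqP us) size_hexads mulKn.
have [n] := ubnP #|U|; elim: n U => // n IH U Un U0 UN Uw.
have [->|[x xU]] := set_0Vmem U; first by exists [::]; split=> // x; rewrite inE.
have x0 : x != 0 by apply: contraNneq U0 => <-.
pose h := [:: x; w x; w (w x)] ++ map -%R [:: x; w x; w (w x)].
have hE : hexad (x, w x) = h by rewrite /h /= ww opprK.
have uh : uniq h.
  have xw : x != w x.
    apply: contraNneq x0 => xw; have := wS x; rewrite -!xw => x3.
    by rewrite [x]V3 // !mulrSr mulr0n add0r.
  apply: uniq_catN => [|y z].
    rewrite /= !inE negb_or xw (inj_eq w_inj) xw /= !andbT.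
    by apply: contraNneq xw => e; rewrite {2}e www.
  have [Sa Sb Sc] : [/\ x + w x = - w (w x), w x + w (w x) = - x &
                        x + w (w x) = - w x].
    split; apply/eqP; rewrite -addr_eq0 ?wS //.
      by rewrite addrC addrA wS.
    by rewrite addrAC wS.
  have dbl (z' : V) : z' != 0 -> z' + z' != 0.
    by apply: contra_neq => zz; apply: V2; rewrite mulr2n.
  rewrite !inE => /or3P[]/eqP-> /or3P[]/eqP->; rewrite ?dbl ?w_eq0 //;
    by rewrite ?[w (w x) + _]addrC ?[w x + x]addrC ?Sa ?Sb ?Sc oppr_eq0 ?w_eq0.
have hN y : (- y \in h) = (y \in h) by rewrite -hE mem_hexadN.
have hw y : y \in h -> w y \in h.
  suff hw' z : z \in [:: x; w x; w (w x)] -> w z \in h.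
    rewrite mem_cat => /orP[/hw' //|/mapP[z /hw' wz ->]].
    by rewrite wN hN.
  by rewrite !inE => /or3P[]/eqP->; rewrite ?www eqxx ?orbT.
have hU y : y \in h -> y \in U.
  suff hU' z : z \in [:: x; w x; w (w x)] -> z \in U.
    by rewrite mem_cat => /orP[/hU' //|/mapP[z /hU' zU ->]]; apply: UN.
  by rewrite !inE => /or3P[]/eqP->; rewrite ?Uw.
have [||||s [us ms]] := IH (U :\: [set y in h]).
- have : (#|U :\ x| < n)%N by move: Un; rewrite (cardsD1 x) xU.
  apply: leq_ltn_trans; rewrite subset_leq_card // setDS // sub1set !inE.
  by rewrite eqxx.
- by rewrite !inE negb_and U0 orbT.
- by move=> y; rewrite !in_setD !in_set hN => /andP[-> /UN].
- move=> y; rewrite !in_setD !in_set => /andP[yh /Uw ->]; rewrite andbT.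
  by apply: contra yh => /hw/hw; rewrite www.
exists ((x, w x) :: s); rewrite hexads_cons hE; split.
  rewrite cat_uniq uh us andbT /=; apply/hasPn=> y.
  by rewrite ms in_setD in_set => /andP[].
move=> y; rewrite mem_cat ms in_setD in_set.
by case: (boolP (y \in h)) => //= /hU ->.
Qed.
End HexadsInj.

(** Makes the plane over ['F_p] a finite abelian group to which [hexads_orbit] applies. *)
HB.instance Definition _ (M N : finZmodType) := Finite.on (M * N)%type.

(** * Hexads in arbitrary abelian groups of odd order *)

Section Skolem.
Variable V : finZmodType.
Hypothesis V_odd : odd #|V|.
Implicit Types H K : {group V}.

Lemma subgD H x y : x \in H -> y \in H -> x + y \in H.
Proof. exact: groupM. Qed.

Lemma subgN H x : (- x \in H) = (x \in H).
Proof. exact: groupV. Qed.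

Lemma subgDr H x y : y \in H -> (x + y \in H) = (x \in H).
Proof. exact: groupMr. Qed.

(** [g] chooses representatives in K of a copy Q of classes modulo H. Each hexad of Q lifts to |H|
    hexads, one for each shift h. They avoid H because hexads of Q avoid 0. *)
Lemma hexads_lift (Q : finZmodType) K H (g : Q -> V) (sQ : seq (Q * Q)) :
  H \subset K -> (forall x, g x \in K) ->
  (forall x y, g (x + y) - (g x + g y) \in H) ->
  (forall x, g x \in H -> x = 0) -> uniq (hexads sQ) ->
  exists s, [/\ uniq (hexads s), {subset hexads s <= K},
    {in hexads s, forall x, x \notin H} & size s = (size sQ * #|H|)%N].
Proof.
move=> sHK gK gD0 g_inj0 usQ.
pose r x y := x - y \in H.
have r_refl x : r x x by rewrite /r subrr; apply: (group1 H).
have r_trans y x z : r x y -> r y z -> r x z.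
  by move=> xy yz; rewrite /r -(subrKA y) subgD.
have r_sym x y : r x y -> r y x by rewrite /r -subgN opprB.
have rD x x' y y' : r x x' -> r y y' -> r (x + y) (x' + y').
  by move=> xx' yy'; rewrite /r opprD addrACA subgD.
have rN x y : r x y -> r (- x) (- y) by move=> xy; rewrite /r -opprD subgN.
have rH x h : h \in H -> r (x + h) x by rewrite /r addrC addKr.
have gD x y : r (g (x + y)) (g x + g y) by apply: gD0.
have g0 : g 0 \in H by have := gD0 0 0; rewrite addr0 opprD addrA subrr sub0r subgN.
have gN x : r (g (- x)) (- g x).
  have := gD (- x) x; rewrite addNr => /r_sym rx.
  by have := subgD rx g0; rewrite subrK /r opprK.
have g_inj x y : r (g x) (g y) -> x = y.
  move=> rxy; apply/eqP; rewrite -subr_eq0; apply/eqP/g_inj0.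
  have : r (g (x - y)) (g x - g y).
    by apply: r_trans (gD _ _) _; apply: rD.
  by move=> rx; have := subgD rx rxy; rewrite subrK.
pose lf p h : V * V := (g p.1 + h, g p.2 + h).
have key p h k : (k < 6)%N -> h \in H ->
    r (nth 0 (hexad (lf p h)) k) (g (nth 0 (hexad p) k)).
  move=> k6 hH; have lD : r (g p.1 + h + (g p.2 + h)) (g (p.1 + p.2)).
    by apply: (r_trans _ _ _ _ (r_sym _ _ (gD _ _))); apply: rD; apply: rH.
  by case: k k6 => [|[|[|[|[|[|k]]]]]] //= _;
    do ?[apply: (r_trans _ _ _ _ (r_sym _ _ (gN _))); apply: rN];
    first [exact: rH | exact: lD].
have us : uniq sQ by apply: uniq_of_hexads.
have inj p q h h' (k l : nat) : p \in sQ -> q \in sQ -> h \in H -> h' \in H ->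
    (k < 6)%N -> (l < 6)%N ->
    nth 0 (hexad (lf p h)) k = nth 0 (hexad (lf q h')) l ->
    [/\ p = q, h = h' & k = l].
  move=> ps qs hH hH' k6 l6 e.
  have /(hexads_inj usQ ps qs k6 l6) [epq ekl] :
      nth 0 (hexad p) k = nth 0 (hexad q) l.
    by apply: g_inj; apply: (r_trans _ _ _ _ (key q _ _ l6 hH')); rewrite -e; apply/r_sym/key.
  subst q l; split=> //.
  (* Up to sign, h is added once in the positions of a and b, and twice in those of c, where
     injectivity of doubling recovers it. *)
  case: k k6 e {l6} => [|[|[|[|[|[|k]]]]]] //= _; do ?[move/oppr_inj];
    do ?[exact: addrI];
    by rewrite addrACA [in RHS]addrACA => /addrI; apply: (double_inj V_odd).
exists [seq lf p h | p <- sQ, h <- enum H].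
split.
- apply: inj_hexads.
    apply: allpairs_uniq => //; first exact: enum_uniq.
    move=> [p h] [q h'] /allpairsP[[p1 h1] [/= ps hH [-> ->]]].
    case/allpairsP=> [[q1 h2] [/= qs hH' [-> ->]]] /= e.
    rewrite !mem_enum in hH hH'.
    by have [|-> -> _] := inj _ _ _ _ 0%N 0%N ps qs hH hH' isT isT; first by case: e.
  move=> _ _ k l /allpairsP[[p h] [/= ps hH ->]] /allpairsP[[q h'] [/= qs hH' ->]].
  move=> k6 l6; rewrite !mem_enum in hH hH' => e.
  by have [-> -> ->] := inj _ _ _ _ _ _ ps qs hH hH' k6 l6 e.
- move=> x /flatten_mapP[_ /allpairsP[[p h] [/= ps hH ->]]]; rewrite mem_enum in hH.
  have hK : h \in K by apply: (subsetP sHK).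
  by rewrite !inE => /or4P[/eqP->|/eqP->|/eqP->|/or3P[/eqP->|/eqP->|/eqP->]];
    rewrite /= ?subgN !subgD.
- move=> x /flatten_mapP[_ /allpairsP[[p h] [/= ps hH ->]]] /(nthP 0)[k k6 <-].
  rewrite mem_enum in hH; apply/negP => xH.
  have nz : nth 0 (hexad p) k != 0.
    by apply: (uniq_hexads0 usQ); apply/flatten_mapP; exists p => //; apply: mem_nth.
  case/eqP: nz; apply: g_inj0.
  have := key p h k k6 hH => /r_sym rx.
  by have := subgD rx xH; rewrite subrK.
by rewrite size_allpairs -cardE.
Qed.

Lemma normal_zmod H K : H \subset K -> (H <| K)%g.
Proof. by move=> sHK; rewrite /normal sHK sub_abelian_norm ?FinRing.zmod_abelian. Qed.

(** The triads consist of 2x, g - x and g + x, with x in half of H. The elements 2x again meet each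
    pair of opposites of H at most once, and the others run through g + H except g. *)
Lemma hexads_index3 K H : H \subset K -> #|K : H|%g = 3%N -> exists s,
  [/\ uniq (hexads s), {subset hexads s <= K} & size s = (#|K|.-1 %/ 6)%N].
Proof.
move=> sHK i3; have nHK := normal_zmod sHK.
have [g gK gH] : exists2 g, g \in K & g \notin H.
  by apply/subsetPn; rewrite -indexg_eq1 i3.
have g2H : g + g \notin H.
  have := expg_mem_index_prime (n := 2) nHK _ gK gH; rewrite i3 => /(_ isT).
  by move=> h; apply/negP => /h.
have oH : odd #|H| by apply: dvdn_odd V_odd; rewrite -cardsT cardSg ?subsetT.
have [||X [uX mX]] := half_system V_odd (U := H :\ 0); first by rewrite !inE eqxx.
  by move=> x; rewrite !inE oppr_eq0 subgN.
have XH x : x \in X -> x \in H.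
  by move=> xX; have := mX x; rewrite mem_cat xX !inE => /esym/andP[].
have sX : (2 * size X).+1 = #|H|.
  have H0 : 0 \in H := group1 H.
  rewrite (cardsD1 0 H) H0 -(eq_card mX) (card_uniqP uX) size_cat size_map.
  by rewrite addnn mul2n.
pose s := [seq (x + x, g - x) | x <- X].
have tri : perm_eq (triads s) (map (fun x => x + x) X ++
                               map (+%R g) (X ++ map -%R X)).
  rewrite /s; elim: (X) => //= x Y IH.
  rewrite perm_cons; apply/seq.permP => P; move/seq.permP/(_ P): IH.
  rewrite -/(triads _) !map_cat /= !count_cat /= => ->.
  by rewrite !count_cat /= [x + x + _]addrC addrA subrK; ring.
exists s; split; last first.
- by rewrite size_map -(Lagrange sHK) i3 -sX third_half.
- move=> x; rewrite (perm_mem (perm_hexads_triads s)) mem_cat.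
  suff sT y : y \in triads s -> y \in K.
    by case/orP=> [/sT //|/mapP[y /sT yK ->]]; rewrite subgN.
  rewrite (perm_mem tri) mem_cat => /orP[/mapP[z /XH zH ->]|/mapP[z + ->]].
    by rewrite subgD // (subsetP sHK).
  by rewrite mX => /setD1P[_ zH]; rewrite subgD // (subsetP sHK).
apply: uniq_hexads; rewrite ?(perm_uniq tri).
  rewrite cat_uniq !map_inj_uniq ?uX; last 2 first.
  - exact: addrI.
  - exact: (double_inj V_odd).
  rewrite andbT; apply/andP; split; first by move: uX; rewrite cat_uniq => /andP[].
  apply/hasPn => _ /mapP[x + ->]; rewrite mX => /setD1P[_ xH].
  apply/mapP => -[y /XH yH e]; case/negP: gH.
  by rewrite -(subgDr g xH) e subgD.
have cases y : y \in triads s -> (exists2 x, x \in X & y = x + x) \/ y - g \in H.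
  rewrite (perm_mem tri) mem_cat => /orP[/mapP[x xX ->]|/mapP[x + ->]].
    by left; exists x.
  by rewrite mX => /setD1P[_ xH]; right; rewrite addrC addKr.
have mix x y : x \in X -> y - g \in H -> x + x + y != 0.
  move=> /XH xH yH; apply: contraNneq gH => e.
  have : x + x + y - (y - g) \in H by rewrite e sub0r subgN.
  by rewrite opprB addrC (addrC (x + x)) subrKA subgDr // subgD.
(* Two doubles are not opposite because [X] is a half system; a double and an element of g + H would
   put g in H; two elements of g + H have their sum in 2g + H, which misses 0. *)
move=> y z /cases[[x xX ->]|yH] /cases[[x' xX' ->]|zH].
- rewrite addrACA addrr_eq0 // addr_eq0; apply: contraL uX => /eqP e.
  rewrite cat_uniq !negb_and negbK; apply/orP; right; apply/orP; left.
  by apply/hasP; exists x => //; rewrite e map_f.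
- exact: mix.
- by rewrite addrC mix.
apply: contraNneq g2H => e; have := subgD yH zH.
by rewrite addrACA e add0r -opprD subgN.
Qed.

Lemma hexads_partition K : exists s,
  [/\ uniq (hexads s), {subset hexads s <= K} & size s = (#|K|.-1 %/ 6)%N].
Proof.
have [n] := ubnP #|K|; elim: n K => // n IH K Kn.
have oK : odd #|K| by apply: dvdn_odd V_odd; rewrite -cardsT cardSg ?subsetT.
have abK : abelian K := FinRing.zmod_abelian K.
have [K3|K3] := boolP (3 %| #|K|)%N.
  have [H sHK iH] := exists_index_prime abK (isT : prime 3) K3.
  exact: hexads_index3 sHK iH.
have [/cyclicP[x ->]|ncK] := boolP (cyclic K); first exact: hexads_cycle.
have [p [H [u [v [p_pr [sHK cK] [uK vK] [up vp] uvH]]]]] :=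
  noncyclic_prime_square_index abK ncK.
have pK : (p %| #|K|)%N by rewrite cK -mulnA dvdn_mulr.
have p_odd : odd p := dvdn_odd pK oK.
have p3 : (p != 3)%N by apply: contraNneq K3 => <-.
have p1 := prime_gt1 p_pr.
pose Q := ('F_p * 'F_p)%type; pose Qz : finZmodType := ('F_p * 'F_p)%type.
(* The companion matrix of X^2 + X + 1. *)
pose w (x : Q) : Q := (- x.2, x.1 - x.2).
have Fp0 (k : nat) (a : 'F_p) : ~~ (p %| k)%N -> a *+ k = 0 -> a = 0.
  move=> pk; rewrite -mulr_natr => /eqP; rewrite mulf_eq0 => /orP[/eqP //|].
  by rewrite -(dvdn_pcharf (pchar_Fp p_pr)) (negPf pk).
have Q0 (k : nat) (x : Q) : ~~ (p %| k)%N -> x *+ k = 0 -> x = 0.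
  have -> : x *+ k = (x.1 *+ k, x.2 *+ k) by elim: k => // k IHk; rewrite !mulrS IHk.
  by case: x => a b pk [/(Fp0 k) -> // /(Fp0 k) ->].
have [||||sQ [usQ sQn]] := @hexads_orbit Qz w.
- by move=> [a b]; rewrite /w; congr (_, _) => /=; rewrite ?opprD.
- move=> [a b]; rewrite /w; congr (_, _) => /=; ring.
- move=> x; apply: Q0; rewrite dvdn_prime2 //; by case: eqP p_odd => [->|].
- by move=> x; apply: Q0; rewrite dvdn_prime2.
(* Coordinates are read as integers below p; the carries in additions are multiples of p u and p v,
   which lie in H. *)
pose g (x : Q) : V := u *+ (x.1 : nat) + v *+ (x.2 : nat).
have gP : [/\ forall x, g x \in K, forall x y, g (x + y) - (g x + g y) \in H
              & forall x, g x \in H -> x = 0].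
  have modp (z : V) m : z *+ p \in H -> z *+ (m %% p) - z *+ m \in H.
    move=> zp; rewrite {2}(divn_eq m p) mulrnDr opprD addrCA subrr addr0 subgN.
    by rewrite mulnC mulrnA; apply: groupX.
  have addE (a b : 'F_p) : nat_of_ord (a + b) = ((a + b) %% p)%N.
    by rewrite -[X in (_ %% X)%N](Fp_cast p_pr).
  have small (a : 'F_p) : (p %| a)%N -> a = 0.
    move=> pa; apply: val_inj => /=; apply/eqP; rewrite -leqn0 leqNgt.
    apply: contraL pa => a0; rewrite gtnNdvd //.
    by have := ltn_ord a; rewrite [X in (_ < X)%N](Fp_cast p_pr).
  split=> [x|x y|[a b] /uvH /= /andP[/small -> /small -> //]].
    by apply: subgD; apply: groupX.
  have -> : g (x + y) = u *+ ((x.1 + y.1) %% p)%N + v *+ ((x.2 + y.2) %% p)%N.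
    by rewrite -!addE.
  rewrite /g addrACA -!mulrnDr opprD addrACA.
  by apply: subgD; apply: modp.
have [gK gD g0] := gP.
have [s1 [us1 s1K s1H ss1]] := @hexads_lift Qz K H g sQ sHK gK gD g0 usQ.
have [|s2 [us2 s2H ss2]] := IH H.
  apply: (leq_trans (_ : #|H| < #|K|)%N) Kn.
  rewrite cK ltn_Pmull ?cardG_gt0 // -mulnn (leq_trans p1) // leq_pmulr //.
  exact: prime_gt0.
exists (s1 ++ s2); split.
- rewrite hexads_cat cat_uniq us1 us2 andbT /=.
  by apply/hasPn => x /s2H; apply: contraL => /s1H.
- by move=> x; rewrite hexads_cat mem_cat => /orP[/s1K|/s2H/(subsetP sHK)].
(* With p^2 = 6k + 1, the order of K minus one is 6k|H| + (|H| - 1): the k|H| lifted hexads account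
   for the first summand, those of H for the second. *)
have [|k pk] := sqr_mod6 p_odd; first by rewrite dvdn_prime2 // eq_sym.
rewrite size_cat ss1 ss2 sQn cK card_prod card_Fp // mulnn pk.
have : (0 < #|H|)%N := cardG_gt0 H.
case: #|H| => // h _; rewrite [_.-1 in LHS]/= mulKn //.
have -> : (((6 * k).+1 * h.+1).-1 = k * h.+1 * 6 + h)%N by rewrite mulSn /=; ring.
by rewrite divnMDl.
Qed.

End Skolem.

(** * Distribution of group elements over the components *)

Section Resources.
Variable V : finZmodType.
Hypothesis V_odd : odd #|V|.

(** The weights of a smallest even star: the centre, then the three leaves. *)
Definition quad (p : V * V * V) :=
  [:: p.1.1 + p.1.2 + p.2; p.1.1; p.1.2; p.2].
Definition octad p := quad p ++ map -%R (quad p).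
Definition octads s := flatten (map octad s).

Lemma size_octads s : size (octads s) = (8 * size s)%N.
Proof. by elim: s => //= p s; rewrite /octads /= => ->; rewrite mulnS. Qed.

Lemma mem_octadsN s x : (- x \in octads s) = (x \in octads s).
Proof.
suff impl y : y \in octads s -> - y \in octads s.
  by apply/idP/idP => [/impl|/impl //]; rewrite opprK.
case/flatten_mapP=> p ps; rewrite mem_cat => yp; apply/flatten_mapP; exists p => //.
rewrite mem_cat; case/orP: yp => [yp|/mapP[z zp ->]]; last by rewrite opprK zp.
by rewrite orbC map_f.
Qed.

Lemma exists_notin (l : seq V) : (size l < #|V|)%N -> exists x, x \notin l.
Proof.
move=> ll; apply/existsP; apply: contraLR ll; rewrite negb_exists -leqNgt => /forallP h.
apply: leq_trans (card_size l); apply/subset_leq_card/subsetP => x _.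
by move: (h x); rewrite negbK.
Qed.

(** Greedy choice of x, y, z. The last one is the tightest: z and x + y + z each avoid 8s + 5
    elements, and one more value is excluded, in all 16s + 11 < 16(s + 1). *)
Lemma octads_exist s : (16 * s <= #|V|)%N ->
  exists l, size l = s /\ uniq (0 :: octads l).
Proof.
elim: s => [|s IH] st; first by exists [::].
have [|l [sl ul0]] := IH; first by apply: leq_trans st; rewrite leq_pmul2l.
have lt m : (m < 16 * s.+1)%N -> (m < #|V|)%N by move/leq_trans; apply.
have [l0 ul] : 0 \notin octads l /\ uniq (octads l) by apply/andP.
 pose U := 0 :: octads l.
have sU : size U = (8 * s).+1 by rewrite /= size_octads sl.
have UN v : (- v \in U) = (v \in U) by rewrite !inE mem_octadsN oppr_eq0.
have [|x xU] := @exists_notin U; first by apply: lt; rewrite sU; lia.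
have [|y] := @exists_notin (U ++ [:: x; - x]); first by apply: lt; rewrite size_cat sU /=; lia.
rewrite mem_cat negb_or => /andP[yU]; rewrite !inE negb_or => /andP[yx yNx].
pose W := U ++ [:: x; - x; y; - y].
have sW : size W = (8 * s + 5)%N by rewrite size_cat sU /=; lia.
(* The value of z for which x + y + z = -z. *)
pose d := finv (fun v : V => v *+ 2) (- (x + y)).
have dE : d *+ 2 = - (x + y) by apply: (f_finv (double_inj V_odd)).
have [|z] := @exists_notin (d :: W ++ [seq w - (x + y) | w <- W]).
  by apply: lt; rewrite -cat1s size_cat size_cat size_map sW /=; lia.
rewrite in_cons negb_or mem_cat negb_or => /and3P[zd zW cW].
have {cW} : x + y + z \notin W.
  by apply: contra cW => cW; apply/mapP; exists (x + y + z) => //; rewrite addrC addKr.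
rewrite mem_cat negb_or => /andP[cU]; move: zW; rewrite mem_cat negb_or => /andP[zU].
rewrite !inE !negb_or => /and4P[zx zNx zy zNy] /and4P[cx cNx cy cNy].
exists ((x, y, z) :: l); split; first by rewrite /= sl.
have U0 v : v \notin U -> v != 0 by apply: contraNneq => ->; rewrite inE eqxx.
have cz : x + y + z != - z.
  apply: contraNneq zd => e; apply/eqP/(double_inj V_odd); rewrite dE.
  apply/eqP; rewrite -addr_eq0 mulr2n -addrA [z + (x + y)]addrC e subrr //.
have Q v : v \in quad (x, y, z) -> v \notin U.
  by rewrite /quad !in_cons in_nil orbF => /or4P[]/eqP->.
rewrite [octads _](_ : _ = octad (x, y, z) ++ octads l) // cons_uniq mem_cat negb_or.
rewrite l0 andbT; apply/andP; split.
  rewrite mem_cat negb_or; apply/andP; split.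
    by apply/negP => /Q/U0; rewrite eqxx.
  by apply/mapP => -[v /Q/U0 v0 /eqP]; rewrite eq_sym oppr_eq0 (negPf v0).
rewrite cat_uniq ul andbT; apply/andP; split; last first.
  apply/hasPn => v vl; have vU : v \in U by rewrite inE vl orbT.
  rewrite mem_cat negb_or; apply/andP; split; first by apply: contraL vU => /Q.
  apply/mapP => -[v' /Q + e]; rewrite -UN -e vU //.
apply: uniq_catN => [|v v'].
  rewrite /= !inE !negb_or cx cy (eq_sym x y) yx (eq_sym x z) zx (eq_sym y z) zy /= !andbT.
  rewrite -subr_eq0 addrK addr_eq0 eq_sym; apply: contraNneq yNx => <-.
  by rewrite opprK.
rewrite !inE => /or4P[]/eqP-> /or4P[]/eqP->;
  rewrite ?addrr_eq0 ?(U0 _ xU) ?(U0 _ yU) ?(U0 _ zU) ?(U0 _ cU) // addr_eq0 ?cx //.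
all: by rewrite eq_sym eqr_oppLR.
Qed.

(** A hexad meeting the symmetric set [A] contains with an element also its opposite, so at most
    half of |A| hexads are lost. *)
Lemma hexads_filter (A : seq V) (s : seq (V * V)) :
  uniq (hexads s) -> uniq A -> (forall x, (- x \in A) = (x \in A)) ->
  exists s', [/\ uniq (hexads s'), {in hexads s', forall x, x \notin A}
    & (size s <= size s' + (size A)./2)%N].
Proof.
move=> us uA AN; pose hit p := has (mem A) (hexad p).
exists [seq p <- s | ~~ hit p]; split.
- suff : uniq (hexads ([seq p <- s | ~~ hit p] ++ [seq p <- s | ~~ ~~ hit p])).
    by rewrite hexads_cat cat_uniq => /andP[].
  by rewrite (perm_uniq (perm_flatten (perm_map _ (permEl (perm_filterC _ s))))).
- move=> x /flatten_mapP[p]; rewrite mem_filter => /andP[/hasPn h _].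
  exact: h.
have cnt : (2 * count hit s <= count (mem A) (hexads s))%N.
  elim: (s) => // p s' IH; rewrite hexads_cons count_cat [count hit _]/= mulnDr.
  apply: leq_add => //; rewrite /hit /= !AN.
  by case: (p.1 \in A); case: (p.2 \in A); case: (p.1 + p.2 \in A).
have le : (count (mem A) (hexads s) <= size A)%N.
  rewrite -size_filter; apply: uniq_leq_size; first exact: filter_uniq.
  by move=> x; rewrite mem_filter => /andP[].
rewrite size_filter -(count_predC hit s) addnC leq_add2l geq_half_double -mul2n.
exact: leq_trans cnt le.
Qed.

(** The 8s elements of the octads spoil at most 4s hexads of a maximal family, so M + 4s hexads must
    be available at the start; this is the origin of 24 = 6 * 4. *)
Lemma hexads_octads_exist (M s : nat) : (6 * M + 24 * s < #|V|)%N ->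
  exists h o, [/\ size h = M, size o = s & uniq (0 :: hexads h ++ octads o)].
Proof.
move=> Ms; have [o [so uo0]] : exists l, size l = s /\ uniq (0 :: octads l).
  by apply: octads_exist; apply: leq_trans (ltnW Ms); lia.
have [o0 uo] : 0 \notin octads o /\ uniq (octads o) by apply/andP.
have [h0 [uh0 _ sh0]] := hexads_partition V_odd [set: V]%G.
have [h1 [uh1 dis]] := hexads_filter uh0 uo (mem_octadsN o).
rewrite {}sh0 size_octads so cardsT => sh1.
have Mh1 : (M <= size h1)%N.
  have : (6 * (M + 4 * s) <= #|V|.-1)%N.
    by rewrite -ltnS prednK; [move: Ms; rewrite mulnDr mulnA | apply: leq_trans Ms].
  rewrite mulnC => /(leq_div2r 6); rewrite mulnK // => /leq_trans/(_ sh1).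
  by rewrite -[(8 * s)%N]/((2 * 4) * s)%N -mulnA mul2n doubleK leq_add2r.
exists (take M h1), o; split=> //; first by rewrite size_takel.
have sub : {subset hexads (take M h1) <= hexads h1}.
  move=> x /flatten_mapP[p /mem_take pM xp]; apply/flatten_mapP.
  by exists p.
rewrite cons_uniq mem_cat negb_or o0 andbT; apply/andP; split.
  by apply/negP => /sub/(uniq_hexads0 uh1); rewrite eqxx.
rewrite cat_uniq uo andbT; apply/andP; split.
  by move: uh1; rewrite -{1}(cat_take_drop M h1) hexads_cat cat_uniq => /andP[].
by apply/hasPn => x xo; apply/negP => /sub/dis; rewrite xo.
Qed.

(* [i.1] and [i.2] are the weights on the two color classes of a component. *)
Definition balanced (i : seq V * seq V) := \sum_(x <- i.1) x == \sum_(x <- i.2) x.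
Definition weights (C : seq (seq V * seq V)) := flatten [seq i.1 ++ i.2 | i <- C].
Definition sizes (i : seq V * seq V) := (size i.1, size i.2).
Definition realizable (l : seq (nat * nat)) := exists C,
  [/\ map sizes C = l, all balanced C & uniq (weights C)].

(** Class sizes [c] can grow to [p] by adding pairs {x, -x} inside each class. *)
Definition enlarges (c p : nat * nat) :=
  [&& c.1 <= p.1, c.2 <= p.2, ~~ odd (p.1 - c.1) & ~~ odd (p.2 - c.2)]%N.
Definition total (l : seq (nat * nat)) := sumn [seq (p.1 + p.2)%N | p <- l].

Lemma realizable_perm l l' : perm_eq l l' -> realizable l' -> realizable l.
Proof.
move=> pl [C [sC bC uC]]; rewrite -{}sC in pl.
have /(perm_iotaP (0%N, 0%N))[Is pI ->] := pl.
exists [seq nth ([::], [::]) C i | i <- Is].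
have pC : perm_eq [seq nth ([::], [::]) C i | i <- Is] C.
  rewrite -[X in perm_eq _ X](mkseq_nth ([::], [::])); apply: perm_map.
  by move: pI; rewrite size_map.
split; last 2 first.
- by rewrite (perm_all _ pC).
- by rewrite (perm_uniq (perm_flatten (perm_map _ pC))).
rewrite -map_comp; apply/eq_in_map => i; rewrite (perm_mem pI) mem_iota size_map => /= iC.
by rewrite (nth_map ([::], [::])).
Qed.

Lemma sum_catN (X : seq V) : \sum_(x <- X ++ map -%R X) x = 0.
Proof. by rewrite big_cat big_map /= sumrN subrr. Qed.

(** The pairs {x, -x} with x in [X] are dealt to the classes in order. Each adds 0 to a class sum,
    and the size equation says that they are used up exactly. *)
Lemma enlarge_weights (C : seq (seq V * seq V)) l (X : seq V) :
  all balanced C -> all2 enlarges (map sizes C) l ->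
  (2 * size X + size (weights C) = total l)%N ->
  exists C', [/\ map sizes C' = l, all balanced C' &
    perm_eq (weights C') (weights C ++ (X ++ map -%R X))].
Proof.
elim: C l X => [|[A B] C IH] [|p l] X //=.
  by move=> _ _; rewrite addn0; case: X => // _; exists [::].
case/andP=> bAB bC /andP[/and4P[/= Ap Bp oA oB] Cl].
rewrite /weights /= -/(weights C) !size_cat /total /= -/(total l) => sX.
pose a := (p.1 - size A)./2; pose b := (p.2 - size B)./2.
have pa : p.1 = (size A + 2 * a)%N by rewrite /a; lia.
have pb : p.2 = (size B + 2 * b)%N by rewrite /b; lia.
have ab : (a + b <= size X)%N.
  suff : (size (weights C) <= total l)%N by lia.
  rewrite /total /weights; elim: (C) (l) Cl => [|i C' IH'] [|q l'] //=.
  move=> /andP[/and4P[/= i1 i2 _ _] /IH' le']; rewrite !size_cat.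
  by apply: leq_add le'; apply: leq_add.
pose X1 := take a X; pose X2 := take b (drop a X); pose X3 := drop b (drop a X).
have eX : X = X1 ++ X2 ++ X3 by rewrite /X1 /X2 /X3 !cat_take_drop.
have s1 : size X1 = a by rewrite size_takel //; lia.
have s2 : size X2 = b by rewrite size_takel // size_drop; lia.
have [|C' [sC' bC' pC']] := IH l X3 bC Cl.
  by move: sX; rewrite /X3 !size_drop pa pb; lia.
exists ((A ++ (X1 ++ map -%R X1), B ++ (X2 ++ map -%R X2)) :: C'); split.
- rewrite /= sC' /sizes /= !size_cat !size_map s1 s2; congr (_ :: _).
  by rewrite [RHS]surjective_pairing pa pb !mul2n !addnn.
- rewrite /= bC' andbT /balanced /= !(big_cat _ A) !(big_cat _ B) /= !sum_catN.
  by rewrite !addr0.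
rewrite /= -/(weights C'); apply/seq.permP => P.
have /seq.permP/(_ P) := pC'; clearbody X1 X2 X3; rewrite {}eX.
rewrite /weights /= !map_cat !count_cat => ->.
ring.
Qed.

Lemma enlarges_total C l : all2 enlarges (map sizes C) l ->
  exists k, (2 * k + size (weights C) = total l)%N.
Proof.
elim: C l => [|[A B] C IH] [|p l] //=; first by exists 0%N.
move=> /andP[/and4P[/= Ap Bp oA oB]] /IH[k].
rewrite /total /weights /= !size_cat => <-.
exists (k + (p.1 - size A)./2 + (p.2 - size B)./2)%N.
lia.
Qed.

Definition star_size (p : nat * nat) := [&& p.1 == 1, odd p.2 & 3 <= p.2]%N.
Definition bip_size (p : nat * nat) := [&& odd p.1, odd p.2, 3 <= p.1 & 3 <= p.2]%N.
(** The odd class comes first, with room for a + b against a and b. *)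
Definition odd_size (p : nat * nat) := [&& odd p.1, ~~ odd p.2 & 2 <= p.2]%N.
Definition even_size (p : nat * nat) := ~~ odd p.1 && ~~ odd p.2.

Lemma perm_size_kinds l :
  all (fun p => [|| star_size p, bip_size p, odd_size p | even_size p]) l ->
  perm_eq l ([seq p <- l | star_size p] ++ [seq p <- l | bip_size p] ++
             [seq p <- l | odd_size p] ++ [seq p <- l | even_size p]).
Proof.
move=> al; apply/seq.permP => P; rewrite !count_cat !count_filter.
elim: l al => //= p l IH /andP[kp /IH ->].
suff : (star_size p + bip_size p + odd_size p + even_size p = 1)%N.
  by rewrite /predI /=; case: (P p); lia.
move: kp; rewrite /star_size /bip_size /odd_size /even_size; lia.
Qed.

Lemma all2_forall (S U : eqType) (r : S -> U -> bool) s t : size s = size t ->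
  (forall x y, x \in s -> y \in t -> r x y) -> all2 r s t.
Proof.
elim: s t => [|x s IH] [|y t] //= [st] h; rewrite h ?mem_head //=.
by apply: IH => // x' y' xs yt; apply: h; rewrite in_cons ?xs ?yt orbT.
Qed.

Lemma all2_cat (S U : Type) (r : S -> U -> bool) s1 s2 t1 t2 :
  all2 r s1 t1 -> all2 r s2 t2 -> all2 r (s1 ++ s2) (t1 ++ t2).
Proof. by elim: s1 t1 => [|x s1 IH] [|y t1] //= /andP[-> /IH h] /h. Qed.

(** [S] holds the reserved elements, and the count clause says that the core repeats none of 0 and
    [S]. All other elements form pairs, and the last inequality says that these suffice for the
    places left open. *)
Lemma realizable_of_core (S : seq V) C l : uniq (0 :: S) ->
  (forall x, (- x \in S) = (x \in S)) ->
  all balanced C -> all2 enlarges (map sizes C) l ->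
  (forall P, count P (weights C) <= count P (0%R :: S))%N ->
  (total l + size S < #|V| + size (weights C))%N -> realizable l.
Proof.
move=> uS SN bC Cl cnt lt.
pose U := [set x | x \notin 0 :: S].
have [|x|X0 [uX mX]] := half_system V_odd (U := U).
- by rewrite inE negbK mem_head.
- by rewrite !inE SN oppr_eq0.
have cU : (2 * size X0 + (size S).+1 = #|V|)%N.
  have := cardsC [set x in 0 :: S]; rewrite cardsE (card_uniqP uS) => <- /=.
  rewrite addnC; congr (_ + _)%N.
  rewrite (_ : ~: _ = U); last by apply/setP => x; rewrite in_setC !inE.
  by rewrite -(eq_card mX) (card_uniqP uX) size_cat size_map mul2n addnn.
have [k ek] := enlarges_total Cl.
have kX : (k <= size X0)%N by rewrite -cU in lt; lia.
have [|C' [sC' bC' pC']] := @enlarge_weights C l (take k X0) bC Cl.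
  by rewrite size_takel.
exists C'; split=> //; rewrite (perm_uniq pC').
have sub : subseq (take k X0 ++ map -%R (take k X0)) (X0 ++ map -%R X0).
  by apply: cat_subseq; rewrite ?map_subseq // take_subseq.
rewrite cat_uniq (subseq_uniq sub uX) andbT; apply/andP; split.
  apply: count_mem_uniq => x.
  have : (count_mem x (weights C) <= 1)%N.
    by apply: leq_trans (cnt (pred1 x)) _; rewrite (count_uniq_mem _ uS) leq_b1.
  by rewrite -has_pred1 has_count; case: (count _ _) => [|[|c]].
apply/hasPn => x /(mem_subseq sub); rewrite mX inE; apply: contra => xC.
move: xC; rewrite -!has_pred1 !has_count => xC.
exact: leq_trans xC (cnt _).
Qed.

Definition star_items (p : V * V * V) :=
  let: (x, y, z) := p in
  [:: ([:: x + y + z], [:: x; y; z]); ([:: - (x + y + z)], [:: - x; - y; - z])].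
Definition odd_items (p : V * V) :=
  [:: ([:: p.1 + p.2], [:: p.1; p.2]); ([:: - (p.1 + p.2)], [:: - p.1; - p.2])].
Definition bip_item (p : V * V) :=
  ([:: p.1; p.2; - (p.1 + p.2)], [:: - p.1; - p.2; p.1 + p.2]).
Definition star0_item (p : V * V) := ([:: p.1 + p.2], [:: 0; p.1; p.2]).
Definition extra_item (e : seq (V * V)) :=
  if e is p :: _ then ([:: - (p.1 + p.2)], [:: - p.1; - p.2]) else ([:: 0], [::]).

Lemma weights_cat C D : weights (C ++ D) = weights C ++ weights D.
Proof. by rewrite /weights map_cat flatten_cat. Qed.

(* [e] holds at most one hexad, for a star without partner; its other half, or
   [0] when there is none, goes to a component of odd order without partner. *)
Definition core (o : seq (V * V * V)) (e h1 h2 : seq (V * V)) (b : bool) m :=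
  ([seq star0_item p | p <- e] ++ flatten [seq star_items p | p <- o]) ++
  [seq bip_item p | p <- h1] ++
  (nseq b (extra_item e) ++ flatten [seq odd_items p | p <- h2]) ++
  nseq m ([::], [::]).

Lemma core_balanced o e h1 h2 b m : all balanced (core o e h1 h2 b m).
Proof.
have big3 (x y z : V) : \sum_(u <- [:: x; y; z]) u = x + y + z.
  by rewrite !big_cons big_nil addr0 addrA.
have big2 (x y : V) : \sum_(u <- [:: x; y]) u = x + y.
  by rewrite !big_cons big_nil addr0.
rewrite /core !all_cat !all_nseq !all_map; apply/and4P; split.
- apply/andP; split.
    by apply/allP => p _; rewrite /= /balanced /= big_seq1 big3 add0r.
  elim: (o) => // -[[x y] z] o' IH; rewrite map_cons [flatten _]/= /= IH andbT.
  by rewrite /balanced /= !big_seq1 !big3 !opprD !eqxx.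
- by apply/allP => p _; rewrite /= /balanced /= !big3 -opprD addNr subrr.
- rewrite /balanced; apply/andP; split.
    by case: (e) => [|p e'] /=; rewrite ?big_seq1 ?big_nil ?big2 ?opprD eqxx orbT.
  elim: (h2) => // p h IH; rewrite map_cons [flatten _]/= /= IH.
  by rewrite !big_seq1 !big2 opprD !eqxx.
by rewrite /balanced !big_nil eqxx orbT.
Qed.

Lemma core_count o e h1 h2 (b : bool) m P : (size e <= 1)%N ->
  (count P (weights (core o e h1 h2 b m)) <=
   count P (0%R :: hexads (e ++ h1 ++ h2) ++ octads o))%N.
Proof.
have cO : count P (weights (flatten [seq star_items p | p <- o])) = count P (octads o).
  by elim: (o) => //= -[[x y] z] o' IH; rewrite /weights /= -/(weights _) IH.
have c1 : weights [seq bip_item p | p <- h1] = hexads h1.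
  by elim: (h1) => //= p h IH; rewrite /weights /= -/(weights _) IH.
have c2 : count P (weights (flatten [seq odd_items p | p <- h2])) = count P (hexads h2).
  elim: (h2) => // p h IH; rewrite hexads_cons count_cat -IH.
  by rewrite /weights /=; ring.
have c3 : weights (nseq m ([::], [::])) = [::] :> seq V by elim: (m).
rewrite /core !weights_cat !hexads_cat /= !count_cat cO c1 c2 c3.
move: (count P (octads o)) (count P (hexads h1)) (count P (hexads h2)) => n1 n2 n3.
case: e => [|p [|//]] _; case: b => /=; move: (nat_of_bool (P 0)) => n0; try lia;
  move: (nat_of_bool (P p.1)) (nat_of_bool (P p.2)) (nat_of_bool (P (p.1 + p.2)))
    (nat_of_bool (P (- p.1))) (nat_of_bool (P (- p.2)))
    (nat_of_bool (P (- (p.1 + p.2)))) => *; lia.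
Qed.

Lemma core_size o e h1 h2 (b : bool) m : (size e <= 1)%N ->
  size (weights (core o e h1 h2 b m)) =
  (4 * size e + 8 * size o + 6 * size h1 + 6 * size h2 +
   b * (if e is [::] then 1 else 3))%N.
Proof.
have cO : size (weights (flatten [seq star_items p | p <- o])) = (8 * size o)%N.
  by elim: (o) => //= -[[x y] z] o' IH; rewrite /weights /= -/(weights _) IH; lia.
have c1 : size (weights [seq bip_item p | p <- h1]) = (6 * size h1)%N.
  by elim: (h1) => //= p h IH; rewrite /weights /= -/(weights _) IH; lia.
have c2 : size (weights (flatten [seq odd_items p | p <- h2])) = (6 * size h2)%N.
  by elim: (h2) => //= p h IH; rewrite /weights /= -/(weights _) IH; lia.
have c3 : weights (nseq m ([::], [::])) = [::] :> seq V by elim: (m).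
rewrite /core !weights_cat !size_cat cO c1 c2 c3.
case: e => [|p [|//]] _; case: b => /=; lia.
Qed.

Lemma all2_enlarges (C : seq (seq V * seq V)) (l : seq (nat * nat)) :
  (forall i p, i \in C -> p \in l -> enlarges (sizes i) p) ->
  size C = size l -> all2 enlarges (map sizes C) l.
Proof.
move=> cl Cl; apply: all2_forall => [|_ p /mapP[i iC ->] pl].
  by rewrite size_map.
exact: cl.
Qed.

(** The last bound provides one octad for two stars and one hexad for each other component or pair
    to be balanced. The 3 pays for the idle half hexad when a star is unpaired but no component of
    odd order is. *)
Lemma realizable_sizes (l : seq (nat * nat)) :
  all (fun p => [|| star_size p, bip_size p, odd_size p | even_size p]) l ->
  let n0 := count star_size l in let n1 := count bip_size l in
  let n2 := count odd_size l in
  (total l <= #|V|)%N -> (odd n0 -> ~~ odd n2 -> total l + 3 <= #|V|)%N ->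
  (6 * (n1 + n2./2 + odd n0) + 24 * n0./2 < #|V|)%N -> realizable l.
Proof.
move=> al n0 n1 n2 lt lt3 MV.
have [h [o [sh so uS]]] := hexads_octads_exist MV.
pose e := take (odd n0) h; pose h1 := take n1 (drop (odd n0) h).
pose h2 := drop n1 (drop (odd n0) h).
have eh : h = e ++ h1 ++ h2 by rewrite /e /h1 /h2 !cat_take_drop.
have se : size e = odd n0 by rewrite size_takel // sh leq_addl.
have sh1 : size h1 = n1 by rewrite size_takel // size_drop sh; lia.
have sh2 : size h2 = n2./2 by rewrite !size_drop sh; lia.
have e1 : (size e <= 1)%N by rewrite se leq_b1.
pose m := count even_size l.
pose C := core o e h1 h2 (odd n2) m.
apply: realizable_perm (perm_size_kinds al) _.
have SN x : (- x \in hexads h ++ octads o) = (x \in hexads h ++ octads o).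
  by rewrite !mem_cat mem_hexadsN mem_octadsN.
have eT : total ([seq p <- l | star_size p] ++ [seq p <- l | bip_size p] ++
    [seq p <- l | odd_size p] ++ [seq p <- l | even_size p]) = total l.
  by rewrite /total; apply/esym/perm_sumn/perm_map/perm_size_kinds.
have CE : all2 enlarges (map sizes C) ([seq p <- l | star_size p] ++
    [seq p <- l | bip_size p] ++ [seq p <- l | odd_size p] ++
    [seq p <- l | even_size p]).
  have sstar (q : seq (V * V * V)) :
      size (flatten [seq star_items p | p <- q]) = (2 * size q)%N.
    by elim: q => // -[[x y] z] q IH; rewrite map_cons [flatten _]/= /= IH mulnS.
  have sodd (q : seq (V * V)) :
      size (flatten [seq odd_items p | p <- q]) = (2 * size q)%N.
    by elim: q => // p q IH; rewrite map_cons [flatten _]/= /= IH mulnS.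
  rewrite /C /core map_cat; apply: all2_cat.
    apply: all2_enlarges => [i p iC|].
      rewrite mem_filter => /andP[/and3P[/eqP p1 o2 p3] _].
      suff -> : sizes i = (1%N, 3%N) by rewrite /enlarges /= p1 p3 subnn /= oddB ?o2.
      move: iC; rewrite mem_cat => /orP[/mapP[q _ ->] //|/flatten_mapP[[[x y] z] _]].
      by rewrite !inE => /orP[]/eqP->.
    rewrite size_cat size_map sstar se so size_filter -/n0 mul2n.
    exact: odd_double_half.
  rewrite map_cat; apply: all2_cat.
    apply: all2_enlarges => [_ p /mapP[q _ ->]|]; last by rewrite size_map size_filter.
    rewrite mem_filter => /andP[/and4P[o1 o2 p1 p2] _].
    by rewrite /enlarges /= p1 p2 !oddB // o1 o2.
  rewrite map_cat; apply: all2_cat.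
    apply: all2_enlarges => [i p iC|].
      rewrite mem_filter => /andP[/and3P[o1 o2 p2] _].
      have p1 : (1 <= p.1)%N by case: (p.1) o1.
      suff [->|->] : sizes i = (1%N, 2%N) \/ sizes i = (1%N, 0%N).
      - by rewrite /enlarges /= p1 p2 !oddB // o1 (negPf o2).
      - by rewrite /enlarges /= p1 subn0 !oddB // o1 o2.
      move: iC; rewrite mem_cat => /orP[/nseqP[-> _]|/flatten_mapP[q _]].
        by case: (e) => [|q e'] /=; [right | left].
      by rewrite !inE => /orP[]/eqP->; left.
    rewrite size_cat size_nseq sodd sh2 size_filter -/n2 mul2n.
    exact: odd_double_half.
  apply: all2_enlarges => [_ p /nseqP[-> _]|]; last by rewrite size_nseq size_filter.
  rewrite mem_filter => /andP[/andP[o1 o2] _].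
  by rewrite /enlarges /= !subn0 o1 o2.
apply: (realizable_of_core uS SN (core_balanced o e h1 h2 (odd n2) m) CE) => [P|].
  by rewrite eh; apply: core_count.
rewrite eT size_cat size_hexads size_octads sh so core_size // se so sh1 sh2.
have [k ek] := enlarges_total CE; move: ek.
rewrite eT core_size // se so sh1 sh2.
have := odd_double_half n0; have := odd_double_half n2.
move: lt lt3 V_odd; move: #|V| (total l) => t n.
case: (e) se => [|p e'] /=; case: (odd n0) => //= _; case: (odd n2) => /= *; lia.
Qed.

End Resources.

(** * Components and color classes *)

Section Components.
Variables (T : finType) (e : rel T).
Hypotheses (e_sym : symmetric e) (e_irr : irreflexive e).
Implicit Types (A B C : {set T}).

Let cs := sym_connect_sym e_sym.

Lemma components_partition : partition (components e) [set: T].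
Proof.
apply: equivalence_partitionP => x y z _ _ _; split; first exact: connect0.
by move=> xy; apply: (same_connect cs xy).
Qed.

Lemma componentE C r : C \in components e -> r \in C -> C = [set v | connect e r v].
Proof.
case/imsetP=> x _ ->; rewrite !inE => xr; apply/setP => v.
by rewrite !inE (same_connect cs xr).
Qed.

Lemma component_adj C u v : C \in components e -> u \in C -> e u v -> v \in C.
Proof. by move=> Cc uC uv; rewrite (componentE Cc uC) inE connect1. Qed.

Lemma component_neighbor C x : C \in components e -> x \in C -> (1 < #|C|)%N ->
  exists2 y, y \in C & e x y.
Proof.
move=> Cc xC C1; have [y] : exists y, y \in C :\ x.
  by apply/set0Pn; rewrite -card_gt0; move: C1; rewrite (cardsD1 x C) xC.
rewrite !inE => /andP[yx]; rewrite {1}(componentE Cc xC) inE => /connectP[[|z p] /=].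
  by move=> _ yE; rewrite yE eqxx in yx.
by case/andP=> xz _ _; exists z => //; apply: (component_adj Cc xC xz).
Qed.

Lemma color_classesC C A B : color_classes e C A B = color_classes e C B A.
Proof. by rewrite /color_classes setUC disjoint_sym [independent e B && _]andbC. Qed.

(** Every other vertex has a neighbor, which can only be c. Hence in an odd bipartite component that
    is no star both classes have at least three vertices. *)
Lemma singleton_class_star C c B : C \in components e -> (2 < #|C|)%N -> ~~ odd #|C| ->
  color_classes e C [set c] B -> even_star e C.
Proof.
move=> Cc C3 Co /and4P[/eqP defC dis _ /forall_inP indB].
have cC : c \in C by rewrite -defC !inE eqxx.
have BC x : x \in C -> x != c -> x \in B.
  by rewrite -defC !inE => /predU1P[->|//]; rewrite eqxx.
have iB x y : x \in B -> y \in B -> e x y = false.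
  by move=> /indB/forall_inP h /h/negbTE.
have adj x : x \in C -> x != c -> e x c.
  move=> xC xc; have [y yC xy] := component_neighbor Cc xC (ltnW C3).
  have [<- //|yc] := eqVneq y c.
  by rewrite (iB _ _ (BC _ xC xc) (BC _ yC yc)) in xy.
rewrite /even_star Co /=; apply/andP; split; first by lia.
apply/exists_inP; exists c => //; apply/forall_inP => x xC; apply/forall_inP => y yC.
have [->|xc] := eqVneq x c; have [->|yc] := eqVneq y c; rewrite /= ?e_irr ?andbT ?andbF //.
- by rewrite e_sym adj.
- by rewrite adj.
by rewrite iB ?BC.
Qed.

Lemma even_star_classes C : even_star e C ->
  exists2 c, c \in C & color_classes e C [set c] (C :\ c).
Proof.
case/and3P=> _ _ /exists_inP[c cC /forall_inP adj]; exists c => //.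
apply/and4P; split; first by rewrite setD1K.
- by rewrite disjoints1 !inE eqxx.
- by apply/forall_inP => x /set1P->; apply/forall_inP => y /set1P->; rewrite e_irr.
apply/forall_inP => x /setD1P[xc xC]; apply/forall_inP => y /setD1P[yc yC].
by have /forall_inP/(_ y yC)/eqP-> := adj x xC; rewrite (negPf xc) (negPf yc) andbF.
Qed.

Lemma even_star_odd_bipartite C : even_star e C -> odd_bipartite e C.
Proof.
move=> st; have [c cC cl] := even_star_classes st; have /and3P[Co _ _] := st.
apply/existsP; exists [set c]; apply/existsP; exists (C :\ c).
by move: Co; rewrite cl cards1 (cardsD1 c C) cC /= negbK.
Qed.

Definition splits C (p : {set T} * {set T}) :=
  [&& p.1 :|: p.2 == C, [disjoint p.1 & p.2] &
   color_classes e C p.1 p.2 || ~~ [exists A, exists B, color_classes e C A B]].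

Definition side_sizes (p : {set T} * {set T}) := (#|p.1|, #|p.2|).

(** Non-bipartite components are split as one vertex against the rest if the order is odd, and as
    everything against nothing if it is even. *)
Lemma split_component C : C \in components e -> (2 < #|C|)%N -> exists p,
  [/\ splits C p, star_size (side_sizes p) = even_star e C,
      bip_size (side_sizes p) = odd_bipartite e C && ~~ even_star e C,
      odd_size (side_sizes p) = odd #|C| &
      [|| star_size (side_sizes p), bip_size (side_sizes p),
          odd_size (side_sizes p) | even_size (side_sizes p)] ].
Proof.
move=> Cc C3; have card_cl A B : color_classes e C A B -> (#|A| + #|B| = #|C|)%N.
  by case/and4P=> /eqP <- dis _ _; rewrite cardsU disjoint_setI0 // cards0 subn0.
have spl A B : color_classes e C A B -> splits C (A, B).
  by move=> cl; rewrite /splits /= cl; case/and4P: cl => -> ->.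
have [st|nst] := boolP (even_star e C).
  have [c cC cl] := even_star_classes st; have /and3P[Co C4 _] := st.
  have cC1 : (#|C :\ c|.+1 = #|C|)%N by rewrite (cardsD1 c C) cC.
  exists ([set c], C :\ c).
  rewrite /side_sizes /star_size /bip_size /odd_size /even_size /= cards1.
  have o1 : odd #|C :\ c| by rewrite -cC1 /= negbK in Co.
  split; rewrite ?spl ?(negPf Co) ?o1 ?andbF //=; by lia.
have [ob|nob] := boolP (odd_bipartite e C).
  have /existsP[A /existsP[B /and3P[cl oA oB]]] := ob.
  have sC := card_cl _ _ cl.
  have Co : ~~ odd #|C| by rewrite -sC oddD oA oB.
  have no1 A' B' : color_classes e C A' B' -> #|A'| <> 1%N.
    move=> cl' /eqP/cards1P[c Ac]; move: cl'; rewrite Ac.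
    by move=> /(singleton_class_star Cc C3 Co); apply/negP.
  have A1 := no1 _ _ cl; have B1 : #|B| <> 1%N by apply: (no1 B A); rewrite color_classesC.
  exists (A, B); rewrite /side_sizes /star_size /bip_size /odd_size /even_size /=.
  rewrite oA oB (negPf Co) spl //; split=> //; lia.
have [ex|nex] := boolP [exists A, exists B, color_classes e C A B]; last first.
  have [Co|Ce] := boolP (odd #|C|).
    have [c cC] : exists c, c \in C by apply/set0Pn; rewrite -card_gt0; lia.
    have cC1 : (#|C :\ c|.+1 = #|C|)%N by rewrite (cardsD1 c C) cC.
    exists ([set c], C :\ c); rewrite /side_sizes /star_size /bip_size /odd_size /even_size /=.
    rewrite cards1 /splits /= nex orbT setD1K // eqxx disjoints1 !inE eqxx.
    by split=> //; lia.
  exists (C, set0); rewrite /side_sizes /star_size /bip_size /odd_size /even_size /=.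
  rewrite cards0 /splits /= nex orbT setU0 eqxx -setI_eq0 setI0 eqxx Ce.
  by split=> //; lia.
have [A [B cl]] : exists A B, color_classes e C A B.
  by have /existsP[A /existsP[B cl]] := ex; exists A, B.
have nboth : ~~ (odd #|A| && odd #|B|).
  apply: contra nob => /andP[oA oB]; apply/existsP; exists A; apply/existsP; exists B.
  by rewrite cl oA.
have sC := card_cl _ _ cl.
have B0 A' B' : color_classes e C A' B' -> (0 < #|B'|)%N.
  move=> /and4P[/eqP defC _ /forall_inP indA _]; rewrite lt0n; apply/negP => /eqP/cards0_eq B0.
  have [x xC] : exists c, c \in C by apply/set0Pn; rewrite -card_gt0; lia.
  have [y yC xy] := component_neighbor Cc xC (ltnW C3).
  have CA : C = A' by rewrite -defC B0 setU0.
  by rewrite CA in xC yC; have /forall_inP/(_ y yC) := indA _ xC; rewrite xy.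
(* The odd class of a component of odd order is put first. *)
wlog oAB : A B cl nboth sC / odd #|C| -> odd #|A|.
  move=> gen; have [oA|eA] := boolP (odd #|A|); first exact: (gen A B).
  apply: (gen B A); rewrite 1?color_classesC // 1?andbC // 1?addnC // -sC oddD.
  by rewrite (negPf eA).
have A0 : (0 < #|A|)%N by apply: (B0 B A); rewrite color_classesC.
have {}B0 := B0 _ _ cl.
exists (A, B); rewrite /side_sizes /star_size /bip_size /odd_size /even_size /=.
rewrite spl //; split=> //; lia.
Qed.

End Components.

(** * Weights realized by edge labelings *)

Section Achievable.
Variables (T : finType) (e : rel T) (V : finZmodType).
Hypotheses (e_sym : symmetric e) (e_irr : irreflexive e) (V_odd : odd #|V|).
Implicit Types (w : T -> V) (A B C : {set T}).

Definition achievable w := exists f : {set T} -> V, forall v, wdeg e f v = w v.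
Definition delta (u : T) (x : V) (z : T) : V := if z == u then x else 0.

Lemma eq_achievable w w' : w =1 w' -> achievable w -> achievable w'.
Proof. by move=> eqw [f fw]; exists f => v; rewrite fw. Qed.

Lemma achievable0 : achievable (fun=> 0).
Proof. by exists (fun=> 0) => v; rewrite /wdeg big1. Qed.

Lemma achievableD w w' : achievable w -> achievable w' ->
  achievable (fun z => w z + w' z).
Proof.
move=> [f fw] [f' fw']; exists (fun S => f S + f' S) => v.
by rewrite /wdeg big_split -/(wdeg e f v) -/(wdeg e f' v) fw fw'.
Qed.

Lemma achievableN w : achievable w -> achievable (fun z => - w z).
Proof. by move=> [f fw]; exists (fun S => - f S) => v; rewrite /wdeg sumrN -fw. Qed.

Lemma achievable_sum (I : Type) (r : seq I) (P : pred I) (F : I -> T -> V) :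
  (forall i, P i -> achievable (F i)) ->
  achievable (fun z => \sum_(i <- r | P i) F i z).
Proof.
move=> aF; elim: r => [|i r IH].
  by apply: eq_achievable achievable0 => z; rewrite big_nil.
have [Pi|NPi] := boolP (P i); last first.
  by apply: eq_achievable IH => z; rewrite big_cons (negPf NPi).
by apply: eq_achievable (achievableD (aF _ Pi) IH) => z; rewrite big_cons Pi.
Qed.

Lemma set2_eql (a b c : T) : ([set a; b] == [set a; c]) = (b == c).
Proof.
apply/eqP/eqP => [E|-> //]; have := set22 a b; have := set22 a c.
by rewrite E -[in X in X -> _]E !inE => /predU1P[->|/eqP->] // /predU1P[->|/eqP->].
Qed.

Lemma achievable_edge u v x : e u v -> achievable (fun z => delta u x z + delta v x z).
Proof.
move=> uv; exists (fun S => if S == [set u; v] then x else 0) => z.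
have uNv : u != v by apply: contraTneq uv => ->; rewrite e_irr.
rewrite /wdeg /delta; have [->|zu] := eqVneq z u.
  rewrite (negPf uNv) addr0 (bigD1 v) //= [[set v; u]]setUC eqxx big1 ?addr0 //.
  by move=> y /andP[_ yv]; rewrite [[set y; u]]setUC set2_eql (negPf yv).
have [->|zv] := eqVneq z v.
  rewrite add0r (bigD1 u) /=; last by rewrite e_sym.
  rewrite eqxx big1 ?addr0 // => y /andP[_ yu].
  by rewrite [[set y; v]]setUC [[set u; v]]setUC set2_eql (negPf yu).
rewrite addr0 big1 // => y _; case: eqP => // E.
by have := set22 y z; rewrite E !inE (negPf zu) (negPf zv).
Qed.

Lemma sum_delta w (S : {set T}) z :
  \sum_(v in S) delta v (w v) z = if z \in S then w z else 0.
Proof.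
have [zS|zS] := boolP (z \in S).
  rewrite (bigD1 z) //= /delta eqxx big1 ?addr0 // => v /andP[_ vz].
  by rewrite eq_sym (negPf vz).
by rewrite big1 // /delta => v vS; case: eqP => // zv; rewrite zv vS in zS.
Qed.

(* The sign [b] is the parity of a walk from [u] to [v]: alternating [x] and
   [- x] along the walk changes the weighted degrees of its ends only. *)
Definition linked (b : bool) u v :=
  forall x, achievable (fun z => delta v x z + (if b then delta u x z else - delta u x z)).

Lemma linked0 u : linked false u u.
Proof. by move=> x; apply: eq_achievable achievable0 => z; rewrite subrr. Qed.

Lemma linked_edge b u v t : linked b u v -> e v t -> linked (~~ b) u t.
Proof.
move=> uv vt x.
apply: eq_achievable (achievableD (achievable_edge x vt) (achievableN (uv x))) => z.
rewrite opprD addrA (addrC (delta v x z)) addrK.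
by case: b {uv} => /=; rewrite ?opprK.
Qed.

Lemma connect_ind_edge (U : finType) (r : rel U) (P : U -> Prop) x y :
  P x -> (forall y z, P y -> r y z -> P z) -> connect r x y -> P y.
Proof.
move=> Px Pr /connectP[p]; elim: p x Px => [|z p IH] x Px /= => [_ -> //|].
by move=> /andP[/(Pr _ _ Px) Pz]; apply: IH.
Qed.

(** Each weight w v is carried from v to a root r along a walk. The amounts left at r have the
    opposite signs for the two classes and cancel by balance. *)
Lemma achievable_bipartite C A B w : C \in components e -> color_classes e C A B ->
  \sum_(v in A) w v = \sum_(v in B) w v ->
  achievable (fun z => if z \in C then w z else 0).
Proof.
move=> Cc; have [r rC] : exists r, r \in C.
  apply/set0Pn; have /and3P[_ _ n0] := components_partition e_sym.
  by apply: contraNneq n0 => <-.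
wlog rA : A B / r \in A.
  move=> gen cl; have /and4P[/eqP defC _ _ _] := cl.
  have := rC; rewrite -{1}defC inE => /orP[rA|rB] eAB; first exact: (gen A B).
  by apply: (gen B A); rewrite ?eAB // color_classesC.
move=> /and4P[/eqP defC dis /forall_inP indA /forall_inP indB] eAB.
have lk v : v \in C -> v \in A /\ linked false r v \/ v \in B /\ linked true r v.
  rewrite (componentE e_sym Cc rC) inE; move: v.
  pose P v := v \in C /\ (v \in A /\ linked false r v \/ v \in B /\ linked true r v).
  suff H v : connect e r v -> P v by move=> v /H[].
  apply: (@connect_ind_edge _ e P r v) => [|{}v z [vC ALT] vz].
    by split=> //; left; split=> //; apply: linked0.
  have zC := component_adj e_sym Cc vC vz; split=> //.
  move: zC; rewrite -defC inE => /orP[zA|zB]; case: ALT => -[vX lv].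
  - by have /forall_inP/(_ _ zA) := indA _ vX; rewrite vz.
  - by left; split=> //; apply: linked_edge lv vz.
  - by right; split=> //; apply: linked_edge lv vz.
  by have /forall_inP/(_ _ zB) := indB _ vX; rewrite vz.
have disAB v : v \in A -> v \in B -> False.
  by move=> vA; rewrite (disjointFr dis vA).
have lA v : v \in A -> linked false r v.
  move=> vA; have [|[_ //]|[vB]] := lk v; first by rewrite -defC inE vA.
  by case: (disAB _ vA vB).
have lB v : v \in B -> linked true r v.
  move=> vB; have [|[vA]|[_ //]] := lk v; first by rewrite -defC inE vB orbT.
  by case: (disAB _ vA vB).
have aA := achievable_sum (index_enum T) (fun v vA => lA v vA (w v)).
have aB := achievable_sum (index_enum T) (fun v vB => lB v vB (w v)).
apply: eq_achievable (achievableD aA aB) => z /=.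
have sum_r (S : {set T}) : \sum_(v in S) delta r (w v) z = delta r (\sum_(v in S) w v) z.
  by rewrite /delta; case: eqP => // _; rewrite big1.
rewrite !big_split /= sumrN !sum_delta !sum_r eAB addrACA addNr addr0.
rewrite -defC inE; have [zA|zA] := boolP (z \in A); last by rewrite add0r.
by case: (boolP (z \in B)) => [/(disAB _ zA) //|_]; rewrite addr0.
Qed.

Lemma achievable_nonbipartite C w : C \in components e ->
  ~~ [exists A, exists B, color_classes e C A B] ->
  achievable (fun z => if z \in C then w z else 0).
Proof.
move=> Cc ncl; have [r rC] : exists r, r \in C.
  apply/set0Pn; have /and3P[_ _ n0] := components_partition e_sym.
  by apply: contraNneq n0 => <-.
(* The bipartite double cover: [W b] collects the ends of walks from [r] of parity [b]. *)
pose e2 (p q : T * bool) := e p.1 q.1 && (p.2 != q.2).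
pose W b := [set v | connect e2 (r, false) (v, b)].
have lkW b v : v \in W b -> linked b r v.
  rewrite inE => rv; suff : forall q, connect e2 (r, false) q -> linked q.2 r q.1.
    by move=> /(_ _ rv).
  move=> q; apply: (@connect_ind_edge _ e2 (fun q => linked q.2 r q.1)) => [|[v1 b1] [v2 b2] /= l1].
    exact: linked0.
  case/andP=> /= vz b12; have -> : b2 = ~~ b1 by case: (b1) (b2) b12 => [] [].
  exact: linked_edge l1 vz.
have W0 : r \in W false by rewrite inE connect0.
have Wstep b v z : v \in W b -> e v z -> z \in W (~~ b).
  rewrite !inE => rv vz; apply: connect_trans rv (connect1 _).
  by rewrite /e2 /= vz; case: b.
have CW v : v \in C -> v \in W false :|: W true.
  rewrite (componentE e_sym Cc rC) inE; 
  apply: (@connect_ind_edge _ e (fun v => v \in W false :|: W true)) => [|{}v z].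
    by rewrite in_setU W0.
  rewrite !in_setU => + vz; case/orP => /Wstep/(_ vz) /=; first by move=> ->; rewrite orbT.
  by move=> ->.
(* If [W false] and [W true] were disjoint, they would cut out color classes of [C]. *)
have [v v0 v1] : exists2 v, v \in W false & v \in W true.
  apply/exists_inP; apply: contraNT ncl; rewrite negb_exists_in => /forall_inP dis.
  apply/existsP; exists (W false :&: C); apply/existsP; exists (W true :&: C).
  have ind b : independent e (W b :&: C).
    apply/forall_inP => v /setIP[vb _]; apply/forall_inP => z /setIP[zb _].
    apply/negP => vz; have := Wstep _ _ _ vb vz; case: b vb zb => /= vb zb zb'.
      by have := dis _ zb'; rewrite zb.
    by have := dis _ zb; rewrite zb'.
  apply/and4P; split=> //; last first.
    rewrite -setI_eq0; apply/eqP/setP => v; rewrite in_set0 !in_setI.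
    by apply/negP => /andP[/andP[/dis + _] /andP[+ _]] => /negP h /h.
  rewrite -setIUl; apply/eqP/setIidPr/subsetP => v; exact: CW.
(* Walks of both parities from [r] to [v] differ by 2y at [r] alone, and y is chosen as half of
   x. *)
have ar x : achievable (delta r x).
  pose y := finv (fun v : V => v *+ 2) x.
  have yE : y *+ 2 = x by apply: (f_finv (double_inj V_odd)).
  apply: eq_achievable (achievableD (lkW _ _ v1 y) (achievableN (lkW _ _ v0 y))) => z.
  rewrite opprD opprK addrACA subrr add0r /delta -yE mulr2n.
  by case: eqP => //; rewrite addr0.
have av v' x : v' \in C -> achievable (delta v' x).
  move=> /CW; rewrite in_setU => /orP[] /lkW/(_ x) h.
    by apply: eq_achievable (achievableD h (ar x)) => z /=; rewrite subrK.
  by apply: eq_achievable (achievableD h (achievableN (ar x))) => z /=; rewrite addrK.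
have aC := achievable_sum (index_enum T) (fun v' v'C => av v' (w v') v'C).
apply: eq_achievable aC => z /=; rewrite sum_delta //.
Qed.

End Achievable.

(** * Balanced irregular weights *)

Lemma total_lower_bound l :
  all (fun p => [|| star_size p, bip_size p, odd_size p | even_size p]) l ->
  (4 * count star_size l + 6 * count bip_size l + 3 * count odd_size l <= total l)%N /\
  odd (total l) = odd (count odd_size l).
Proof.
elim: l => //= p l IH /andP[kp /IH[le par]].
rewrite /total /= -/(total l) !oddD par.
move: (count star_size l) (count bip_size l) (count odd_size l) (total l) le {par}.
case: p kp => a b; rewrite /star_size /bip_size /odd_size /even_size /= => kp n0 n1 n2 n le.
case/or4P: kp => [/and3P[/eqP-> ob b3]|/and4P[oa ob a3 b3]|/and3P[oa ob b2]|/andP[oa ob]].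
- by rewrite ob b3 /=; split; [lia | case: (odd n2)].
- have -> : (a == 1)%N = false by lia.
  by rewrite oa ob a3 b3 /=; split; [lia | case: (odd n2)].
- rewrite oa (negPf ob) b2 /= andbF; split; last by case: (odd n2).
  by case: a oa => // a _; lia.
by rewrite (negPf oa) (negPf ob) /= andbF; split; [lia | case: (odd n2)].
Qed.

(** [n1] excludes the stars, whence [n1 + q0]. The first two bounds come from the first term of the
    maximum. The third comes from the second term if q0 > 0; for q0 = 0 it follows from n <= t, the
    lower bound on n and the oddness of t. *)
Lemma group_order_bounds (t n q0 n1 q2 : nat) : odd t -> odd n = odd q2 ->
  (4 * q0 + 6 * n1 + 3 * q2 <= n)%N ->
  n%:Z + K n q0 (q4 n q0 (n1 + q0)%N q2) <= t%:Z ->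
  [/\ (n <= t)%N, (odd q0 -> ~~ odd q2 -> n + 3 <= t)%N &
      (6 * (n1 + q2./2 + odd q0) + 24 * q0./2 < t)%N].
Proof.
move=> ot on n_ge; rewrite /K addr_maxr ge_max => /andP[].
have := lez_floor; rewrite /q4 /epsilon -on => floor.
have := odd_double_half q0; have := odd_double_half q2.
move: (q0./2) (q2./2) => s k; rewrite uphalf_half; rewrite -on.
case: (odd q0) => /=; case: (boolP (odd n)) => /= [o1|o1] e2 e0;
  set X := (X in (X %/ 2)%Z); move: (floor X 2 isT); rewrite {}/X; move: (_ %/ 2)%Z => d;
  split; lia.
Qed.

Lemma labels_of_lists (T : eqType) (V : Type) (x0 : V) (ss : seq (seq T)) (tt : seq (seq V)) :
  uniq (flatten ss) -> shape ss = shape tt -> exists w : T -> V, map (map w) ss = tt.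
Proof.
move=> us sh; exists (fun v => nth x0 (flatten tt) (index v (flatten ss))).
set w := fun v => _.
apply: eq_from_flatten_shape; last first.
  by rewrite -sh /shape -map_comp; apply: eq_map => s /=; rewrite size_map.
have sz : size (flatten ss) = size (flatten tt) by rewrite !size_flatten sh.
rewrite -map_flatten; apply: (@eq_from_nth _ x0); first by rewrite size_map.
move=> i; rewrite size_map => il; have [v0 vl] : exists v0, v0 \in flatten ss.
  by case: (flatten ss) il => // v s; exists v; rewrite mem_head.
by rewrite (nth_map v0) // /w index_uniq.
Qed.

(** With the two sides as consecutive lists, [shape] records both class sizes. *)
Definition two_lists (T : Type) (L : seq (seq T * seq T)) :=
  flatten [seq [:: p.1; p.2] | p <- L].

Lemma two_lists_inj T : injective (@two_lists T).
Proof.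
elim=> [|[a b] L IH] [|[c d] M] //.
by rewrite /two_lists /= => -[-> -> /IH ->].
Qed.

Lemma shape_two_lists (T : Type) (L : seq (seq T * seq T)) :
  shape (two_lists L) =
  flatten [seq [:: q.1; q.2] | q <- [seq (size p.1, size p.2) | p <- L]].
Proof. by elim: L => //= p L <-. Qed.

Lemma uniq_map_inj (T U : eqType) (w : T -> U) (s : seq T) :
  uniq (map w s) -> {in s &, injective w}.
Proof.
move=> us u v us' vs' e; apply/eqP.
rewrite -(nth_index u us') -[v in X in _ == X](nth_index u vs').
have us1 : uniq s := map_uniq us.
rewrite nth_uniq ?index_mem // -(nth_uniq (w u) _ _ us) ?size_map ?index_mem //.
by rewrite !(nth_map u) ?index_mem // !nth_index // e.
Qed.

Lemma flatten_two_lists (T : Type) (L : seq (seq T * seq T)) :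
  flatten (two_lists L) = flatten [seq p.1 ++ p.2 | p <- L].
Proof. by elim: L => //= p L <-; rewrite catA. Qed.

Lemma count_enum_set (T : finType) (A : {set T}) (a : pred T) :
  count a (enum A) = #|[set x in A | a x]|.
Proof.
rewrite -size_filter cardE; apply: perm_size; apply: uniq_perm.
- by rewrite filter_uniq ?enum_uniq.
- exact: enum_uniq.
by move=> x; rewrite mem_filter !mem_enum inE andbC.
Qed.

Theorem lemma2p5 (T : finType) (e : rel T)
    (e_sym : symmetric e) (e_irr : irreflexive e)
    (no_small : forall C : {set T}, C \in components e -> (3 <= #|C|)%N)
    (Gamma : finZmodType) (Gamma_odd : odd #|Gamma|) :
  let n := #|T| in
  let q0 := num_even_stars e in
  let q1 := num_odd_bipartite e in
  let q2 := num_odd_order e in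
  n%:Z + K n q0 (q4 n q0 q1 q2) <= #|Gamma|%:Z ->
  exists f : {set T} -> Gamma, irregular_labeling e f.
Proof.
move=> n q0 q1 q2 Kle; have partC := components_partition e_sym.
(* A split is chosen for all sets at once; sets that are not components get a dummy value. *)
have /fin_all_exists[S SP] (C : {set T}) : exists p : {set T} * {set T},
    C \in components e ->
    [/\ splits e C p, star_size (side_sizes p) = even_star e C,
      bip_size (side_sizes p) = odd_bipartite e C && ~~ even_star e C,
      odd_size (side_sizes p) = odd #|C| &
      [|| star_size (side_sizes p), bip_size (side_sizes p),
          odd_size (side_sizes p) | even_size (side_sizes p)] ].
  have [Cc|NCc] := boolP (C \in components e); last by exists (set0, set0).
  by have [p Pp] := split_component e_sym e_irr Cc (no_small _ Cc); exists p.
pose lC := enum (components e).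
have lCP C : (C \in lC) = (C \in components e) by rewrite mem_enum.
pose l := [seq side_sizes (S C) | C <- lC].
have al : all (fun p => [|| star_size p, bip_size p, odd_size p | even_size p]) l.
  by apply/allP => _ /mapP[C CC ->]; case: (SP C); rewrite -?lCP.
have n0E : count star_size l = q0.
  rewrite count_map /q0 /num_even_stars -count_enum_set.
  by apply: eq_in_count => C; rewrite lCP => /SP[_ <-].
have n1E : (count bip_size l + q0)%N = q1.
  rewrite count_map /q0 /q1 /num_even_stars /num_odd_bipartite -!count_enum_set.
  rewrite (eq_in_count (a2 := fun C => odd_bipartite e C && ~~ even_star e C)); last first.
    by move=> C; rewrite lCP => /SP[_ _ <-].
  rewrite -/lC; elim: (lC) => //= C L <-; rewrite addnACA; congr (_ + _)%N.
  by case: (boolP (even_star e C)) => [/(even_star_odd_bipartite e_irr) ->|];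
    rewrite ?andbF ?andbT ?addn0.
have n2E : count odd_size l = q2.
  rewrite count_map /q2 /num_odd_order -count_enum_set.
  by apply: eq_in_count => C; rewrite lCP => /SP[_ _ _ <-].
have Ssplit C : C \in components e ->
    [/\ (S C).1 :|: (S C).2 = C & [disjoint (S C).1 & (S C).2]].
  by move=> /SP[/and3P[/eqP ? ? _]].
have totE : total l = n.
  rewrite /total /l -map_comp sumnE big_map big_enum /= /n -cardsT (card_partition partC).
  apply: eq_bigr => C /Ssplit[sC dis]; rewrite -[in RHS]sC cardsU disjoint_setI0 //.
  by rewrite cards0 subn0.
have [n_ge n_par] := total_lower_bound al.
rewrite n0E n2E totE in n_ge n_par.
have [le1 le3 leM] : [/\ (n <= #|Gamma|)%N, (odd q0 -> ~~ odd q2 -> n + 3 <= #|Gamma|)%N &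
    (6 * (count bip_size l + q2./2 + odd q0) + 24 * q0./2 < #|Gamma|)%N].
  by apply: group_order_bounds => //; rewrite n1E.
have [||| I [sI bI uI]] := realizable_sizes Gamma_odd al; rewrite ?n0E ?n2E ?totE //.
pose sides := [seq (enum (S C).1, enum (S C).2) | C <- lC].
have sE : flatten (two_lists sides) = flatten [seq enum (S C).1 ++ enum (S C).2 | C <- lC].
  by rewrite flatten_two_lists -map_comp.
have in_sides v : v \in flatten (two_lists sides).
  have /and3P[/eqP covC _ _] := partC.
  have : v \in cover (components e) by rewrite covC inE.
  case/bigcupP=> C Cc vC; rewrite sE; apply/flatten_mapP; exists C; rewrite ?lCP //.
  by rewrite mem_cat !mem_enum -in_setU; have [-> _] := Ssplit _ Cc.
have size_sides : size (flatten (two_lists sides)) = n.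
  rewrite sE size_flatten -totE /total /l /shape -!map_comp; congr sumn.
  by apply: eq_map => C /=; rewrite size_cat -!cardE.
(* A list of length n that contains all n vertices has no repetition. *)
have uniq_sides : uniq (flatten (two_lists sides)).
  apply: (leq_size_uniq (enum_uniq T)) => [v _|]; first exact: in_sides.
  by rewrite size_sides -cardE.
have sh : shape (two_lists sides) = shape (two_lists I).
  rewrite !shape_two_lists -[X in _ = flatten (map _ X)]/(map (@sizes Gamma) I) sI.
  suff -> : [seq (size p.1, size p.2) | p <- sides] = l by [].
  rewrite /sides -map_comp; apply: eq_map => C /=.
  by rewrite /side_sizes -!cardE.
have [w wE] := labels_of_lists 0 uniq_sides sh.
have w_inj : injective w.
  have : uniq (map w (flatten (two_lists sides))).
    by rewrite map_flatten wE flatten_two_lists.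
  by move/uniq_map_inj => inj u v; apply: inj.
have IE : I = [seq (map w (enum (S C).1), map w (enum (S C).2)) | C <- lC].
  apply: two_lists_inj; rewrite -wE /sides /two_lists map_flatten -!map_comp.
  by congr flatten; apply: eq_map.
have bal C : C \in components e -> \sum_(v in (S C).1) w v = \sum_(v in (S C).2) w v.
  rewrite -lCP => CC; have /allP/(_ (map w (enum (S C).1), map w (enum (S C).2))) := bI.
  by rewrite IE map_f // /balanced /= !big_map !big_enum => /(_ isT)/eqP.
have aC C : C \in components e -> achievable e (fun z => if z \in C then w z else 0).
  move=> Cc; have [/and3P[_ _ /orP[cl|ncl]] _ _ _ _] := SP C Cc.
    exact: achievable_bipartite cl (bal C Cc).
  exact: achievable_nonbipartite.
(* The labelings for the single components are added; at each vertex only the term of its own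
   component survives. *)
have [f fw] : achievable e w.
  apply: eq_achievable
    (@achievable_sum T e Gamma _ (index_enum _) (mem (components e)) _ aC) => z /=.
  have /and3P[/eqP covC tC _] := partC.
  have zc : z \in cover (components e) by rewrite covC inE.
  rewrite (bigD1 (pblock (components e) z)) ?pblock_mem //= mem_pblock zc big1 ?addr0 //.
  move=> C /andP[Cc]; case: ifP => // zC; by rewrite (def_pblock tC Cc zC) eqxx.
by exists f => u v uv; rewrite !fw => /w_inj.
Qed.
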